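(* Let $E$ be a finite set and $V \subset \mathbb R^E$ a linear subspace, with matroid Schubert variety $Y_V$ and totally non-negative matroid Schubert variety $\mathcal Y_V$. For subsets $F \subset G \subset E$ let $\mathcal Y_{FG}^\circ := \mathcal Y_V \cap (0^F \times \mathbb R_{>0}^{G \setminus F} \times \infty^{E \setminus G})$ and let $\mathcal Y_{FG}$ be the closure of $\mathcal Y_{FG}^\circ$ in the analytic topology. \begin{enumerate} \item $\mathcal Y_{FG}^\circ$ is nonempty if and only if $F \subset G$ are acyclic flats of $V$. In this case, $\mathcal Y_{FG}^\circ$ is a single connected component of $Y_{FG}^\circ$, and is a semi-algebraic cell isomorphic to $(\mathbb R_{>0})^{\mathrm{rk}(G) - \mathrm{rk}(F)}$. \item The closure $\mathcal Y_{FG}$ of a nonempty cell $\mathcal Y_{FG}^\circ$ decomposes as the disjoint union of the cells $\mathcal Y_{F'G'}^\circ$ with $F \subset F' \subset G' \subset G$ (and $F',G'$ acyclic flats). \item This decomposition makes $\mathcal Y_{FG}$ (for $\mathcal Y_{FG}^\circ$ nonempty) a regular CW complex homeomorphic to a closed ball. \end{enumerate}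
   Context: $\mathbb P^1_{\mathbb R} = \mathbb R \cup \{\infty\}$, and $(\mathbb P^1_{\mathbb R})^E$ contains $\mathbb R^E$ as an open subset. The matroid Schubert variety $Y_V$ is the Zariski closure of $V$ in $(\mathbb P^1_{\mathbb R})^E$. The totally non-negative matroid Schubert variety $\mathcal Y_V$ is the closure of $V \cap \mathbb R_{\geq 0}^E$ in $(\mathbb P^1_{\mathbb R})^E$ with respect to the analytic (Euclidean) topology. For disjoint $A,B,C$ with $A\cup B\cup C=E$, the notation $0^A \times S^B \times \infty^C$ denotes the set of points of $(\mathbb P^1_{\mathbb R})^E$ whose coordinates indexed by $A$ are $0$, whose coordinates indexed by $B$ lie in $S$, and whose coordinates indexed by $C$ are $\infty$. A flat of $V$ is a set $F \subset E$ such that there is $v \in V$ whose zero coordinates are exactly those indexed by $F$. A flat $F$ is acyclic if $V \cap (0^F \times \mathbb R_{>0}^{E \setminus F})$ is nonempty. The rank $\mathrm{rk}(F)$ of a flat $F$ is the codimension in $V$ of $V \cap \{x_i = 0 : i \in F\}$. For flats $F \subset G$, $Y_{FG}^\circ := Y_V \cap (0^F \times (\mathbb R\setminus\{0\})^{G \setminus F} \times \infty^{E \setminus G})$. A CW complex is regular if the closure of each cell is homeomorphic to a closed Euclidean ball. *)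

(* Defs.v *)
From HB Require Import structures.
From mathcomp Require Import all_boot all_order all_algebra all_classical all_reals all_analysis.
Import numFieldNormedType.Exports.
Set Implicit Arguments.
Unset Strict Implicit.
Unset Printing Implicit Defensive.
Import Order.TTheory GRing.Theory Num.Theory.
Local Open Scope classical_set_scope.
Local Open Scope ring_scope.

(* P^1_R = R ∪ {∞} with its analytic topology: the one-point
   compactification of R ([Some a] = a, [None] = ∞).  (P^1_R)^E carries
   the product topology.                                               *)
Notation P1 R := (one_point_compactification R).
Notation PE R E := {ptws E -> one_point_compactification R}.

(* Polynomials with real coefficients in variables indexed by a finite
   type I, given as finite lists of terms (coefficient, exponent vector). *)
Definition polyf (R : realType) (I : finType) := seq (R * (I -> nat)).

Definition peval (R : realType) (I : finType) (f : polyf R I) (x : I -> R) : R :=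
  \sum_(t <- f) t.1 * \prod_(i : I) x i ^+ t.2 i.

(* Multihomogeneous polynomials on (P^1)^E: variables x_e = inl e,
   y_e = inr e ([x_e : y_e] homogeneous coordinates of the e-th factor),
   every monomial has degree d e in (x_e, y_e). *)
Definition multihom (R : realType) (E : finType) (d : E -> nat)
  (f : polyf R (E + E)%type) : bool :=
  all (fun t => [forall e, t.2 (inl e) + t.2 (inr e) == d e]%N) f.

Definition hcoord (R : realType) (p : option R) : R * R :=
  if p is Some a then (a, 1) else (1, 0).

Definition hom_eval (R : realType) (E : finType) (f : polyf R (E + E)%type)
  (p : E -> option R) : R :=
  peval f (fun i => match i with
                    | inl e => (hcoord (p e)).1
                    | inr e => (hcoord (p e)).2 end).

Definition zariski_closure (R : realType) (E : finType) (A : set (PE R E))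
  : set (PE R E) :=
  [set p | forall (d : E -> nat) (f : polyf R (E + E)%type), multihom d f ->
     (forall q, A q -> hom_eval f q = 0) -> hom_eval f p = 0].

Definition is_subspace (R : realType) (E : finType) (V : set (E -> R)) : Prop :=
  V (fun _ => 0) /\ forall (a : R) u v, V u -> V v -> V (fun e => a * u e + v e).

Definition is_flat (R : realType) (E : finType) (V : set (E -> R)) (F : {set E})
  : Prop := exists v, V v /\ forall e, (v e == 0) = (e \in F).

Definition is_acyclic_flat (R : realType) (E : finType) (V : set (E -> R))
  (F : {set E}) : Prop :=
  is_flat V F /\
  exists v, [/\ V v, (forall e, e \in F -> v e = 0) & (forall e, e \notin F -> 0 < v e)].

Definition has_dim (R : realType) (E : finType) (W : set (E -> R)) (n : nat) : Prop :=
  exists b : 'I_n -> E -> R,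
    [/\ (forall i, W (b i)),
        (forall c : 'I_n -> R, (forall e, \sum_i c i * b i e = 0) -> forall i, c i = 0)
      & (forall w, W w -> exists c : 'I_n -> R, forall e, w e = \sum_i c i * b i e)].

Definition vanish_on (R : realType) (E : finType) (V : set (E -> R)) (F : {set E}) :=
  V `&` [set v | forall e, e \in F -> v e = 0].

Definition is_rank (R : realType) (E : finType) (V : set (E -> R)) (F : {set E})
  (r : nat) : Prop :=
  exists n m, [/\ has_dim V n, has_dim (vanish_on V F) m & r = (n - m)%N].

Definition embed (R : realType) (E : finType) (v : E -> R) : PE R E :=
  fun e => Some (v e).

Definition schubert (R : realType) (E : finType) (V : set (E -> R)) : set (PE R E) :=
  zariski_closure [set p | exists v, V v /\ p = embed v].

Definition tnn_schubert (R : realType) (E : finType) (V : set (E -> R))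
  : set (PE R E) :=
  closure [set p | exists v, [/\ V v, forall e, 0 <= v e & p = embed v]].

Definition stratum (R : realType) (E : finType) (F G : {set E}) (S : set R)
  : set (PE R E) :=
  [set p | forall e,
     [/\ (e \in F -> p e = Some 0),
         (e \in G :\: F -> exists r, S r /\ p e = Some r)
       & (e \notin G -> p e = None)]].

Definition Y_alg_cell (R : realType) (E : finType) (V : set (E -> R)) (F G : {set E}) :=
  schubert V `&` stratum F G [set r | r != 0].

Definition Y_tnn_cell (R : realType) (E : finType) (V : set (E -> R)) (F G : {set E}) :=
  tnn_schubert V `&` stratum F G [set r | 0 < r].

Definition Y_tnn_closed_cell (R : realType) (E : finType) (V : set (E -> R))
  (F G : {set E}) := closure (Y_tnn_cell V F G).

Inductive semialg (R : realType) (I : finType) : set (I -> R) -> Prop :=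
| semialg_pos (f : polyf R I) : semialg [set x | 0 < peval f x]
| semialg_zero (f : polyf R I) : semialg [set x | peval f x = 0]
| semialg_union A B : semialg A -> semialg B -> semialg (A `|` B)
| semialg_compl A : semialg A -> semialg (~` A).

Definition graph_on (R : realType) (I J : finType) (A : set (I -> R))
  (h : (I -> R) -> (J -> R)) : set ((I + J)%type -> R) :=
  [set z | A (fun i => z (inl i)) /\ h (fun i => z (inl i)) = (fun j => z (inr j))].

Definition homeo_on (X Y : topologicalType) (A : set X) (B : set Y) (f : X -> Y)
  : Prop :=
  exists g : Y -> X,
    [/\ (forall x, A x -> B (f x)), (forall y, B y -> A (g y)),
        (forall x, A x -> g (f x) = x), (forall y, B y -> f (g y) = y)
      & {within A, continuous f} /\ {within B, continuous g}].

Definition euclid_closed_ball (R : realType) (d : nat) : set {ptws 'I_d -> R} :=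
  [set x | \sum_i x i ^+ 2 <= 1].
Definition euclid_open_ball (R : realType) (d : nat) : set {ptws 'I_d -> R} :=
  [set x | \sum_i x i ^+ 2 < 1].
Definition pos_orthant (R : realType) (k : nat) : set {ptws 'I_k -> R} :=
  [set x | forall i, 0 < x i].

Arguments euclid_closed_ball R d : clear implicits.
Arguments euclid_open_ball R d : clear implicits.
Arguments pos_orthant R k : clear implicits.

Definition chart (R : realType) (E : finType) (G : {set E}) (x : {ptws E -> R})
  : PE R E := fun e => if e \in G then Some (x e) else None.

Definition regular_cw (R : realType) (E : finType) (X : set (PE R E))
  (C : set (set (PE R E))) : Prop :=
  [/\ finite_set C,
      X = \bigcup_(c in C) c,
      (forall c, C c -> c !=set0),
      (forall c c', C c -> C c' -> c <> c' -> c `&` c' = set0)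
    & forall c, C c ->
        (exists (d : nat) (phi : {ptws 'I_d -> R} -> PE R E),
            homeo_on (euclid_closed_ball R d) (closure c) phi /\
            phi @` euclid_open_ball R d = c)
        /\ closure c = \bigcup_(c' in [set c' | C c' /\ c' `<=` closure c]) c'].

Definition sub_pair (R : realType) (E : finType) (V : set (E -> R))
  (F G F' G' : {set E}) : Prop :=
  [/\ F \subset F', F' \subset G', G' \subset G,
      is_acyclic_flat V F' & is_acyclic_flat V G'].

(* Main.v *)
Require Import Defs.
From HB Require Import structures.
From mathcomp Require Import all_boot all_order all_algebra all_classical all_reals all_analysis.
From mathcomp Require Import lra ring.
Import numFieldNormedType.Exports.
Set Implicit Arguments.
Unset Strict Implicit.
Unset Printing Implicit Defensive.
Import Order.TTheory GRing.Theory Num.Theory.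
Local Open Scope classical_set_scope.
Local Open Scope ring_scope.

(** A point p of [0,oo]^E lies in the non-negative Schubert variety iff for every M it has a
    lift: a vector of V agreeing with p at its finite coordinates and larger than M at the
    infinite ones.  The difference of two lifts witnesses that the set of finite coordinates is
    an acyclic flat, and a lift witnesses the same for the zero set; this gives the cells and
    their closures.

    An open cell is a relatively open polyhedral cone.  If c is a point of it, a point x is
    determined by min_e x_e / c_e > 0 and by its class modulo c, so the cone is semialgebraically
    R_{>0} times a vector space.

    For the closed cell put W = pi_G(V_F), where V_F is the subspace of V vanishing on F, and
    send p to the functional mu(p) = sum_e exp(- p_e / c_e) ev_e / c_e on W, with weight 0
    where p_e = oo.  Monotonicity of the exponential makes mu injective, and translation by t c
    multiplies it by exp(- t), so that p |-> (max_e exp(- p_e / c_e)) mu(p) / mu(p)(c) is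
    injective as well.  Minimising the convex function sum_e exp(- x_e / c_e) + xi(x) shows that
    the open cell is mapped onto the interior of the dual cone truncated by xi(c) <= 1, a convex
    body.  Its gauge then produces a continuous bijection from the compact closed cell to a
    Euclidean ball. *)

(** * Linear algebra *)

(** Why mu is rescaled: as x runs over all of W, the functionals with weights exp(- x_e / c_e) sweep
    the whole interior of the dual cone, while the cell is cut out by x > 0, that is by all weights
    being < 1, in general a nonlinear condition on mu. Dividing by c_e gives every ev_e / c_e the
    value 1 at c, so translation by t c moves along a ray of the dual cone, and the factor in front
    acts ray by ray. After it the value at c is the largest weight itself, and positivity of x
    becomes the one linear inequality xi(c) < 1. Injectivity is needed on the boundary too, where
    coordinates are infinite and p - q has no meaning. A lift of p exceeding the finite coordinates
    of q, and a lift of q exceeding those of p, have a difference of the right sign at every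
    coordinate where p and q differ; monotonicity uses nothing more. Surjectivity is shown by
    minimisation on the open cell only. The image of the closed cell is compact and contains the
    open ball, hence contains the closed one, so the faces of the dual cone are never examined. *)

Section Subspaces.
Variables (R : realType) (E : finType).
Implicit Types (V W : set (E -> R)) (F G H : {set E}).

Lemma subspace0 V : is_subspace V -> V (fun=> 0).
Proof. by case. Qed.

Lemma subspaceZ V a u : is_subspace V -> V u -> V (fun e => a * u e).
Proof.
move=> [h0 h] Vu; have := h a u _ Vu h0.
by congr V; apply/funext => e; rewrite addr0.
Qed.

Lemma subspaceB V u v : is_subspace V -> V u -> V v -> V (fun e => u e - v e).
Proof.
move=> [_ h] Vu Vv; have := h (-1) v u Vv Vu.
by congr V; apply/funext => e; rewrite mulN1r addrC.
Qed.

Lemma subspace_sum V (I : Type) (r : seq I) (P : pred I) (c : I -> R) (f : I -> E -> R) :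
  is_subspace V -> (forall i, V (f i)) -> V (fun e => \sum_(i <- r | P i) c i * f i e).
Proof.
move=> hV hf; elim: r => [|i r IH].
  by have := subspace0 hV; congr V; apply/funext => e; rewrite big_nil.
case: (boolP (P i)) => Pi.
  have := hV.2 (c i) _ _ (hf i) IH.
  by congr V; apply/funext => e; rewrite big_cons Pi.
by move: IH; congr V; apply/funext => e; rewrite big_cons (negbTE Pi).
Qed.

Lemma vanish_on_subspace V F : is_subspace V -> is_subspace (vanish_on V F).
Proof.
move=> hV; split; first by split; [exact: subspace0|].
move=> a u v [Vu u0] [Vv v0]; split; first exact: hV.2.
by move=> e eF /=; rewrite u0// v0// mulr0 addr0.
Qed.

Lemma set_add_ind (P : {set E} -> Prop) :
  P finset.set0 -> (forall e G, e \notin G -> P G -> P (e |: G)) -> forall G, P G.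
Proof.
move=> P0 PS G; have [n] := ubnP #|G|; elim: n G => // n IH G.
have [->//|/set0Pn[e eG]] := eqVneq G finset.set0.
rewrite (cardsD1 e) eG add1n ltnS => ltn.
rewrite -(finset.setD1K eG); apply: PS; first by rewrite !inE eqxx.
exact: IH.
Qed.

(** Gaussian elimination, one coordinate of [G] at a time. The map sending w to the sum of w_i [t i]
    over [G] is a linear section of the restriction of [V] to [G]. Being defined on every w, it also
    turns approximate or limiting data into vectors of [V]. *)
Lemma section_exists V G : is_subspace V -> exists t : E -> E -> R,
  (forall e, V (t e)) /\
  (forall v, V v -> forall e, e \in G -> \sum_(i in G) v i * t i e = v e).
Proof.
move=> hV; elim/set_add_ind: G => [|e0 G e0G [t [tV tG]]].
  by exists (fun _ _ => 0); split => [e|v _ e]; [exact: subspace0|rewrite inE].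
(* Either some [k] serves as pivot for [e0], and the old vectors are corrected to vanish there, or
   the coordinate at [e0] is already determined by those in [G]. *)
have [[k [Vk kG k0]]|nok] := pselect (exists k,
    [/\ V k, (forall e, e \in G -> k e = 0) & k e0 <> 0]).
  pose k1 e := (k e0)^-1 * k e.
  have k1e0 : k1 e0 = 1 by rewrite /k1 mulVf//; apply/eqP.
  have k1G e : e \in G -> k1 e = 0 by move=> eG; rewrite /k1 (kG _ eG) mulr0.
  have Vk1 : V k1 by exact: subspaceZ.
  exists (fun i e => if i == e0 then k1 e else t i e - t i e0 * k1 e); split.
    move=> e; case: eqVneq => _ //; apply: subspaceB => //; exact: subspaceZ.
  move=> v Vv e; rewrite big_setU1//= eqxx.
  have -> : \sum_(i in G) v i * (if i == e0 then k1 e else t i e - t i e0 * k1 e) =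
      \sum_(i in G) v i * t i e - (\sum_(i in G) v i * t i e0) * k1 e.
    rewrite mulr_suml -sumrB; apply: eq_bigr => i iG.
    have -> : (i == e0) = false by apply: contraNF e0G => /eqP <-.
    ring.
  rewrite !inE => /orP[/eqP ->|eG]; first by rewrite k1e0; ring.
  by rewrite tG// k1G//; ring.
exists (fun i e => if i == e0 then 0 else t i e); split.
  by move=> e; case: eqVneq => _ //; exact: subspace0.
move=> v Vv e; rewrite big_setU1//= eqxx mulr0 add0r.
have -> : \sum_(i in G) v i * (if i == e0 then 0 else t i e) = \sum_(i in G) v i * t i e.
  apply: eq_bigr => i iG.
  by have -> : (i == e0) = false by apply: contraNF e0G => /eqP <-.
rewrite !inE => /orP[/eqP ->|eG]; last exact: tG.
apply: contrapT => /eqP; rewrite -subr_eq0 => /eqP ne; apply: nok.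
exists (fun e => \sum_(i in G) v i * t i e - v e); split=> //.
  by apply: subspaceB => //; exact: subspace_sum.
by move=> e' e'G; rewrite tG// subrr.
Qed.

(** Filters [W] by the vectors supported in a growing set [H]: each new coordinate is a single
    linear form, so it adds at most one basis vector. *)
Lemma has_dim_exists W : is_subspace W -> exists n, has_dim W n.
Proof.
move=> hW.
have main H : exists n, has_dim (vanish_on W (~: H)) n.
  elim/set_add_ind: H => [|e0 H e0H [n [b [bW bI bS]]]].
    exists 0%N; exists (fun _ _ => 0); split; [by case|by move=> c _ []|].
    move=> w [_ w0]; exists (fun=> 0) => e.
    by rewrite big_ord0 w0// finset.setC0 inE.
  have sub v : vanish_on W (~: H) v -> vanish_on W (~: (e0 |: H)) v.
    case=> Wv v0; split=> // e; rewrite !inE negb_or => /andP[_ eH].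
    by apply: v0; rewrite inE.
  have [[k [Wk k0] ke0]|nok] :=
      pselect (exists2 k, vanish_on W (~: (e0 |: H)) k & k e0 <> 0).
    exists n.+1; exists (fun i => if unlift ord0 i is Some j then b j else k); split.
    - by move=> i; case: unliftP => [j|] _; [exact: sub|].
    - move=> c hc.
      have c0 : c ord0 = 0.
        have := hc e0; rewrite big_ord_recl unlift_none big1 ?addr0.
          by move/eqP; rewrite mulf_eq0 => /orP[/eqP//|/eqP].
        move=> i _; rewrite liftK; have [_ -> //] := bW i; rewrite ?mulr0// inE.
        by rewrite e0H.
      have cS : forall j, c (lift ord0 j) = 0.
        apply: bI => e; have := hc e; rewrite big_ord_recl c0 mul0r add0r => h.
        by rewrite -[RHS]h; apply: eq_bigr => i _; rewrite liftK.
      by move=> i; case: (unliftP ord0 i) => [j ->|->].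
    - move=> w [Ww w0].
      have : vanish_on W (~: H) (fun e => w e - w e0 / k e0 * k e).
        split; first by apply: subspaceB => //; exact: subspaceZ.
        move=> e eH /=; have [->|ne] := eqVneq e e0.
          by rewrite divfK ?subrr//; apply/eqP.
        move: eH; rewrite inE => eH.
        have eH' : e \in ~: (e0 |: H) by rewrite !inE (negbTE ne).
        by rewrite (w0 _ eH') (k0 _ eH') mulr0 subrr.
      case/bS => c hc.
      exists (fun i => if unlift ord0 i is Some j then c j else w e0 / k e0) => e.
      rewrite big_ord_recl unlift_none.
      under eq_bigr do rewrite !liftK.
      by rewrite -hc; ring.
  exists n; suff -> : vanish_on W (~: (e0 |: H)) = vanish_on W (~: H) by exists b.
  apply/seteqP; split => // v Wv; split; first by case: Wv.
  move=> e eH; have [->|ne] := eqVneq e e0; first last.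
    by case: Wv => _; apply; move: eH; rewrite !inE (negbTE ne).
  by apply: contrapT => v0; apply: nok; exists v.
have [n] := main (finset.setTfor E); rewrite finset.setCT => hn; exists n.
suff -> : W = vanish_on W finset.set0 by [].
by apply/seteqP; split=> [v Wv|v []//]; split=> // e; rewrite inE.
Qed.

Definition coord_mx n (b : 'I_n -> E -> R) : 'M[R]_(n, #|E|) :=
  \matrix_(i, j) b i (enum_val j).

Lemma coord_mx_mul n m (c : 'M[R]_(m, n)) (b : 'I_n -> E -> R) i j :
  (c *m coord_mx b) i j = \sum_k c i k * b k (enum_val j).
Proof. by rewrite mxE; apply: eq_bigr => k _; rewrite mxE. Qed.

Lemma coord_mx_free n (b : 'I_n -> E -> R) :
  (forall c : 'I_n -> R, (forall e, \sum_i c i * b i e = 0) -> forall i, c i = 0) ->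
  row_free (coord_mx b).
Proof.
move=> bI; apply: inj_row_free => v v0; apply/rowP => i; rewrite mxE.
apply: (bI (fun i => v 0 i)) => e.
have := congr1 (fun M : 'M[R]_(1, #|E|) => fun_of_matrix M 0 (enum_rank e)) v0.
by rewrite coord_mx_mul mxE enum_rankK.
Qed.

(** Independence makes the coordinate matrix row free; the columns of a right inverse are the dual
    vectors. *)
Lemma dual_basis n (b : 'I_n -> E -> R) :
  (forall c : 'I_n -> R, (forall e, \sum_i c i * b i e = 0) -> forall i, c i = 0) ->
  exists beta : 'I_n -> E -> R, forall i j, \sum_e beta i e * b j e = (i == j)%:R.
Proof.
move=> /coord_mx_free/row_freeP[B' hB'].
exists (fun i e => B' (enum_rank e) i) => i j.
have := congr1 (fun M : 'M[R]_n => fun_of_matrix M j i) hB'; rewrite !mxE eq_sym => <-.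
rewrite [LHS](reindex (fun k : 'I_#|E| => enum_val k)) /=; last first.
  by exists enum_rank => k _; rewrite ?enum_valK ?enum_rankK.
by apply: eq_bigr => k _; rewrite mxE enum_valK mulrC.
Qed.

Lemma has_dim_le W n m : has_dim W n -> has_dim W m -> (n <= m)%N.
Proof.
move=> [b [bW bI bS]] [b' [b'W b'I b'S]].
pose c i := proj1_sig (cid (b'S _ (bW i))).
have hc i e : b i e = \sum_k c i k * b' k e by exact: (proj2_sig (cid (b'S _ (bW i)))).
have := coord_mx_free bI; rewrite -row_leq_rank => /leq_trans; apply.
have -> : coord_mx b = (\matrix_(i, k) c i k) *m coord_mx b'.
  by apply/matrixP => i j; rewrite coord_mx_mul mxE hc; apply: eq_bigr => k _; rewrite mxE.
by apply: leq_trans (mxrankM_maxl _ _) _; exact: rank_leq_col.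
Qed.

Lemma has_dim_uniq W n m : has_dim W n -> has_dim W m -> n = m.
Proof. by move=> hn hm; apply/eqP; rewrite eqn_leq (has_dim_le hn hm) (has_dim_le hm hn). Qed.

(* Coordinates on the image of [W] in R^G, together with their number. *)
Lemma relative_basis W G : is_subspace W ->
  exists k (b beta : 'I_k -> E -> R),
  [/\ (forall j, W (b j)),
      (forall i j, \sum_(e in G) beta i e * b j e = (i == j)%:R),
      (forall w, W w -> forall e, e \in G ->
         w e = \sum_j (\sum_(i in G) beta j i * w i) * b j e)
    & forall n m, has_dim W n -> has_dim (vanish_on W G) m -> n = (m + k)%N].
Proof.
move=> hW; have [t [tW tG]] := section_exists G hW.
pose T (w : E -> R) e := \sum_(i in G) w i * t i e.
have TW w : W (T w) by exact: subspace_sum.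
have Text w w' : {in G, w =1 w'} -> T w = T w'.
  by move=> h; apply/funext => e; apply: eq_bigr => i iG; rewrite h.
have TT w : W w -> T (T w) = T w by move=> Ww; apply: Text => e; exact: tG.
have TL a u v : T (fun e => a * u e + v e) = (fun e => a * T u e + T v e).
  apply/funext => e; rewrite /T mulr_sumr -big_split; apply: eq_bigr => i _ /=; ring.
(* The fixed vectors of the projection [T] form a complement in [W] of the vectors vanishing on [G],
   and are determined by their restriction to [G]. *)
pose W' := W `&` [set w | T w = w].
have hW' : is_subspace W'.
  split; first split; [exact: subspace0| |].
    by apply/funext => e; rewrite /T big1// => i _; rewrite mul0r.
  move=> a u v [Wu Tu] [Wv Tv]; split; first exact: hW.2.
  by rewrite /= TL Tu Tv.
have [k [b [bW' bI bS]]] := has_dim_exists hW'.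
(* Independence survives erasing the coordinates outside [G], so the dual vectors can be paired by
   sums over [G] alone. *)
have bGI (c : 'I_k -> R) :
    (forall e, \sum_i c i * (if e \in G then b i e else 0) = 0) -> forall i, c i = 0.
  move=> hc; apply: bI => e.
  have W's : W' (fun e => \sum_i c i * b i e) by exact: subspace_sum.
  have -> : \sum_i c i * b i e = T (fun e => \sum_i c i * b i e) e by rewrite W's.2.
  rewrite /T big1// => i iG; have := hc i; rewrite iG => ->; exact: mul0r.
have [beta hbeta] := dual_basis bGI.
have hbeta' i j : \sum_(e in G) beta i e * b j e = (i == j)%:R.
  rewrite -hbeta big_mkcond; apply: eq_bigr => e _; case: ifP => // _.
  by rewrite mulr0.
exists k, b, beta; split => //.
- by move=> j; case: (bW' j).
- move=> w Ww e eG.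
  have W'T : W' (T w) by split; [exact: TW|exact: TT].
  have [c hc] := bS _ W'T.
  have wG i : i \in G -> w i = \sum_j c j * b j i by move=> iG; rewrite -hc /T tG.
  rewrite wG//; apply: eq_bigr => j _; congr (_ * _).
  under eq_bigr => i iG do rewrite wG// mulr_sumr.
  rewrite exchange_big /=.
  under eq_bigr => l _.
    under eq_bigr => i _ do rewrite mulrCA.
    rewrite -mulr_sumr hbeta'; over.
  rewrite (bigD1 j)//= eqxx mulr1 big1 ?addr0// => l lj.
  by rewrite eq_sym (negbTE lj) mulr0.
- move=> n m hn [b0 [b0W b0I b0S]]; apply: (has_dim_uniq hn).
  exists (fun i => match fintype.split i with inl i => b0 i | inr i => b i end).
  have splitE (c : 'I_(m + k) -> R) e :
     \sum_(i < m + k) c i * (match fintype.split i with inl i => b0 i | inr i => b i end) e =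
     \sum_i c (lshift k i) * b0 i e + \sum_i c (rshift m i) * b i e.
    rewrite big_split_ord; congr (_ + _); apply: eq_bigr => i _.
      by rewrite -[lshift k i]/(unsplit (inl i)) unsplitK.
    by rewrite -[rshift m i]/(unsplit (inr i)) unsplitK.
  split.
  + by move=> i; case: splitP => j _; [case: (b0W j)|case: (bW' j)].
  + move=> c hc.
    have W's : W' (fun e => \sum_i c (rshift m i) * b i e) by exact: subspace_sum.
    have cr i : c (rshift m i) = 0.
      move: i; apply: bI => e; rewrite -[LHS]/((fun e => \sum_i _) e) -W's.2.
      rewrite /T big1// => i iG; have := hc i; rewrite splitE big1 ?add0r.
        by move=> ->; rewrite mul0r.
      by move=> j _; rewrite (b0W j).2// mulr0.
    have cl i : c (lshift k i) = 0.
      move: i; apply: b0I => e; have := hc e; rewrite splitE.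
      by rewrite [X in _ + X]big1 ?addr0// => i _; rewrite cr mul0r.
    by move=> i; rewrite -[i]splitK; case: (fintype.split i) => j; [exact: cl|exact: cr].
  + move=> w Ww.
    have [c hc] : exists c : 'I_k -> R, forall e, T w e = \sum_i c i * b i e.
      by apply: bS; split; [exact: TW|exact: TT].
    have [c0 hc0] : exists c : 'I_m -> R, forall e, w e - T w e = \sum_i c i * b0 i e.
      apply: b0S; split; first exact: subspaceB.
      by move=> e eG /=; rewrite /T tG// subrr.
    exists (fun i => match fintype.split i with inl i => c0 i | inr i => c i end) => e.
    rewrite splitE.
    have -> : w e = (w e - T w e) + T w e by rewrite subrK.
    rewrite hc0 hc; congr (_ + _); apply: eq_bigr => i _.
      by rewrite -[lshift k i]/(unsplit (inl i)) unsplitK.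
    by rewrite -[rshift m i]/(unsplit (inr i)) unsplitK.
Qed.

Lemma vanish_on_vanish_on V F G : F \subset G ->
  vanish_on (vanish_on V F) G = vanish_on V G.
Proof.
move=> FG; apply/seteqP; split=> v; first by case=> -[].
by case=> Vv v0; split=> //; split=> // e eF; apply: v0; exact: (fintype.subsetP FG).
Qed.

(** [is_rank] subtracts natural numbers; the relative basis for [F] writes dim V as dim V_F plus a
    natural number, which rules out truncation. *)
Lemma rank_diff V F G rF rG n : is_subspace V -> F \subset G ->
  is_rank V F rF -> is_rank V G rG ->
  (forall p q, has_dim (vanish_on V F) p -> has_dim (vanish_on V G) q -> p = (q + n)%N) ->
  (rG - rF)%N = n.
Proof.
move=> hV FG [a [p [ha hp ->]]] [a' [q [ha' hq ->]]] /(_ _ _ hp hq) pq.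
have [k [_ [_ [_ _ _ hk]]]] := relative_basis F hV.
have {}hk := hk _ _ ha hp.
by rewrite -(has_dim_uniq ha ha') hk pq addKn -addnA addKn addnK.
Qed.

End Subspaces.

(** * Topology of (P^1)^E *)

Section PointwiseTopology.

Lemma cvg_ptws (I : eqType) (T : topologicalType) (S : Type) (F : set_system S)
    (FF : Filter F) (g : S -> {ptws I -> T}) (p : {ptws I -> T}) :
  (forall i, (fun s => g s i) @ F --> p i) -> g @ F --> p.
Proof.
move=> h; apply/cvg_sup => i U [V] [[W] oW <-] Wp WU.
apply: (filterS WU) => /=.
by apply: (h i); apply: open_nbhs_nbhs; split.
Qed.

Lemma continuous_ptws (I : eqType) (T X : topologicalType) (f : X -> {ptws I -> T}) :
  (forall i, continuous (fun x => f x i)) -> continuous f.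
Proof. by move=> h x; apply: cvg_ptws => i; exact: h. Qed.

Lemma continuous_coord (I : eqType) (T : topologicalType) (i : I) :
  continuous (fun p : {ptws I -> T} => p i).
Proof. exact: (@proj_continuous I (fun=> T) i). Qed.

Lemma closure_ptws_approx (I : finType) (T : topologicalType) (A : set {ptws I -> T})
    (p : {ptws I -> T}) (U : I -> set T) :
  closure A p -> (forall i, nbhs (p i) (U i)) -> exists2 q, A q & forall i, U i (q i).
Proof.
move=> clp hU.
have : nbhs p [set q : {ptws I -> T} | forall i, U i (q i)].
  apply: (@filter_forall _ I (fun i (q : {ptws I -> T}) => U i (q i)) _ (nbhs_filter p)) => i.
  exact: (@continuous_coord I T i p _ (hU i)).
by move/clp => [q [Aq Uq]]; exists q.
Qed.

Lemma closure_seq (T : topologicalType) (A : set T) (u : nat -> T) (p : T) :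
  (forall n, A (u n)) -> u @ \oo --> p -> closure A p.
Proof.
move=> Au; apply: closed_cvg; first exact: closed_closure.
by apply: nearW => n; exact: subset_closure.
Qed.

Lemma continuous_sumr (R : realType) (X : topologicalType) (I : Type) (r : seq I)
    (P : pred I) (f : I -> X -> R) :
  (forall i, P i -> continuous (f i)) -> continuous (fun x => \sum_(i <- r | P i) f i x).
Proof. by move=> h; apply: continuous_big => //; exact: (@add_continuous R^o). Qed.

Lemma continuous_prodr (R : realType) (X : topologicalType) (I : Type) (r : seq I)
    (P : pred I) (f : I -> X -> R) :
  (forall i, P i -> continuous (f i)) -> continuous (fun x => \prod_(i <- r | P i) f i x).
Proof. by move=> h; apply: continuous_big => //; exact: mul_continuous. Qed.

Lemma continuous_cstr (R : realType) (X : topologicalType) (a : R) :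
  continuous (fun _ : X => a).
Proof. by move=> x; exact: cvg_cst. Qed.

Lemma continuousDr (R : realType) (X : topologicalType) (f g : X -> R) :
  continuous f -> continuous g -> continuous (fun x => f x + g x).
Proof. by move=> cf cg x; apply: cvgD; [exact: cf|exact: cg]. Qed.

Lemma continuousBr (R : realType) (X : topologicalType) (f g : X -> R) :
  continuous f -> continuous g -> continuous (fun x => f x - g x).
Proof. by move=> cf cg x; apply: cvgB; [exact: cf|exact: cg]. Qed.

Lemma continuousNr (R : realType) (X : topologicalType) (f : X -> R) :
  continuous f -> continuous (fun x => - f x).
Proof. by move=> cf x; apply: cvgN; exact: cf. Qed.

Lemma continuousMr (R : realType) (X : topologicalType) (f g : X -> R) :
  continuous f -> continuous g -> continuous (fun x => f x * g x).
Proof. by move=> cf cg x; apply: cvgM; [exact: cf|exact: cg]. Qed.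

Lemma continuousXr (R : realType) (X : topologicalType) (f : X -> R) n :
  continuous f -> continuous (fun x => f x ^+ n).
Proof.
move=> cf; elim: n => [|n IH]; first by move=> x; exact: cvg_cst.
by under [fun x => _]funext do rewrite exprS; exact: continuousMr.
Qed.

Lemma continuous_peval (R : realType) (I : finType) (f : polyf R I) :
  continuous (fun x : {ptws I -> R} => peval f x).
Proof.
apply: (@continuous_sumr R {ptws I -> R} _ f xpredT
  (fun t (x : {ptws I -> R}) => t.1 * \prod_i x i ^+ t.2 i)) => t _.
apply: (@continuousMr R {ptws I -> R} (fun=> t.1)); first exact: continuous_cstr.
apply: (@continuous_prodr R {ptws I -> R} _ _ xpredT
  (fun i (x : {ptws I -> R}) => x i ^+ t.2 i)) => i _.
by apply: (@continuousXr R {ptws I -> R} (fun x => x i)); exact: continuous_coord.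
Qed.

(** The preimage under [g] of a closed set is the image under [f] of a compact one, hence closed.
    The conclusion is about the inverse [g] because a characteristic map goes from the ball to the
    cell. *)
Lemma compact_homeo_on (X Y : topologicalType) (A : set X) (B : set Y)
    (f : X -> Y) (g : Y -> X) : hausdorff_space Y -> compact A ->
  {within A, continuous f} ->
  (forall x, A x -> B (f x)) -> (forall y, B y -> A (g y)) ->
  (forall x, A x -> g (f x) = x) -> (forall y, B y -> f (g y) = y) ->
  homeo_on B A g.
Proof.
move=> hY cA cf fB gA gf fg; exists f; split => //; split => //.
apply/continuous_closedP => C cC; apply/closed_subspaceP.
exists (f @` (A `&` C)).
  apply: compact_closed => //; apply: continuous_compact.
    by apply: continuous_subspaceW cf => x [].
  by apply: compact_closedI.
apply/seteqP; split => y [].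
  move=> [x [Ax Cx] <-] By; split => //.
  by suff : C (g (f x)) by []; rewrite gf.
by move=> /= Cy By; split => //; exists (g y); [split => //; exact: gA|exact: fg].
Qed.

End PointwiseTopology.

(** * The projective line near infinity *)

Section ProjectiveLine.
Variable R : realType.
Implicit Types (a M : R).

Lemma P1_hausdorff : hausdorff_space (P1 R).
Proof.
apply: one_point_compactification_hausdorff; last exact: Rhausdorff.
exact: locally_compactR.
Qed.

Lemma PE_compact (E : eqType) : compact [set: PE R E].
Proof.
have := @tychonoff E (fun=> P1 R) (fun=> setT)
  (fun=> one_point_compactification_compact).
by congr compact; apply/seteqP.
Qed.

Lemma nbhs_None M : nbhs (None : P1 R) [set q : P1 R | if q is Some a then M < `|a| else True].
Proof.
exists `[- M, M]%classic.
  by split; [exact: segment_compact|exact: interval_closed].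
move=> [a|//] [[b /= nb [<-]]|//].
by rewrite ltNge; apply/negP; rewrite ler_norml => h; apply: nb; rewrite in_itv.
Qed.

Lemma nbhs_Some a (U : set R) : nbhs a U ->
  nbhs (Some a : P1 R) [set q : P1 R | if q is Some b then U b else False].
Proof. by []. Qed.

Lemma cvg_None (S : Type) (F : set_system S) (FF : Filter F) (u : S -> R) :
  (forall M, \forall s \near F, M < u s) -> (fun s => Some (u s) : P1 R) @ F --> (None : P1 R).
Proof.
move=> h U [C [cC _] CU].
have [M [_ hM]] := compact_bounded cC.
apply: (@filterS _ _ _ [set s | Num.max (M + 1) 0 < u s]) (h _) => s /= us.
apply: CU; left; exists (u s) => // Cus.
have := hM (M + 1) _ _ Cus; rewrite ltrDl ltr01 => /(_ isT).
have := ler_norm (u s); have := le_max (M + 1) (M + 1) 0; rewrite lexx /=.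
lra.
Qed.

Lemma P1_closed1 (x : P1 R) : closed [set x].
Proof. exact: accessible_closed_set1 (hausdorff_accessible P1_hausdorff) _. Qed.

(* The absolute value makes the function continuous at infinity, which is approached from
   both ends of the real line. *)
Definition P1_exp (c : R) (q : P1 R) : R := if q is Some a then expR (- (`|a| / c)) else 0.

Lemma P1_exp_continuous c : 0 < c -> continuous (P1_exp c).
Proof.
move=> c0 [a|].
  have h : (fun a : R => P1_exp c (Some a)) @ a --> P1_exp c (Some a).
    rewrite /=; apply: continuous_comp; last exact: continuous_expR.
    apply: (@continuousNr R R (fun a => `|a| / c)).
    apply: continuousMr; [exact: norm_continuous|by move=> x; exact: cvg_cst].
  by move=> U /h.
have FN : Filter (nbhs (None : P1 R)) := nbhs_filter (None : P1 R).
apply/(@cvgrPdist_lt _ R^o _ _ FN) => e e0.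
(* Once |b| > c / e, the tangent bound exp y >= 1 + y gives exp(|b| / c) > 1 / e. *)
apply: (@filterS _ _ FN) (nbhs_None (c * e^-1)) => -[b|] /=; last by rewrite subrr normr0.
move=> hb; rewrite sub0r normrN ger0_norm ?expR_ge0// expRN invf_plt ?posrE ?expR_gt0//.
apply: le_lt_trans (_ : e^-1 <= `|b| / c) _.
  by rewrite ler_pdivlMr// mulrC ltW.
by have := expR_ge1Dx (`|b| / c); lra.
Qed.

Lemma P1_exp_ge0 c q : 0 <= P1_exp c q.
Proof. by case: q => //= a; exact: expR_ge0. Qed.

End ProjectiveLine.

(** * Lifts and the cell decomposition *)

Section Lifts.
Variables (R : realType) (E : finType).
Implicit Types (V W : set (E -> R)) (F G H : {set E}) (p q : PE R E).

Definition nonneg_pt p := forall e a, p e = Some a -> 0 <= a.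

(** Finite coordinates are matched exactly, not approximately: lifts can then be subtracted and
    shifted by linear algebra, without limits. *)
Definition lifts V p := forall M : R, exists v, [/\ V v,
  (forall e a, p e = Some a -> v e = a) & (forall e, p e = None -> M < v e)].

Lemma fin_bound (f : E -> R) : exists2 M, 0 <= M & forall e, f e <= M.
Proof.
exists (\sum_e `|f e|); first by apply: sumr_ge0.
move=> e; apply: le_trans (ler_norm _) _.
by rewrite (bigD1 e)//= lerDl sumr_ge0.
Qed.

Lemma cvg_shrink (a b : R) : (fun n : nat => a + b / n.+1%:R) @ \oo --> a.
Proof.
rewrite -[X in _ --> X]addr0 -[X in _ + X](mulr0 b).
apply: cvgD; first exact: cvg_cst.
by apply: cvgM; [exact: cvg_cst|exact: cvg_harmonic].
Qed.

Lemma cvg_None_nat (u : nat -> R) : (forall n, n%:R < u n) ->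
  (fun n => Some (u n) : P1 R) @ \oo --> (None : P1 R).
Proof.
move=> h; apply: cvg_None => M; near=> n; apply: lt_trans (h n).
by near: n; exact: nbhs_infty_gtr.
Unshelve. all: by end_near. Qed.

Lemma tnn_approx V p : tnn_schubert V p -> forall eps M : R, 0 < eps ->
  exists v, [/\ V v, forall e, 0 <= v e, forall e a, p e = Some a -> `|v e - a| < eps
     & forall e, p e = None -> M < v e].
Proof.
move=> hp eps M eps0.
pose U e : set (P1 R) := if p e is Some a
  then [set q : P1 R | if q is Some b then `|b - a| < eps else False]
  else [set q : P1 R | if q is Some b then Num.max M 0 < `|b| else True].
have hU e : nbhs (p e) (U e).
  rewrite /U; case: (p e) => [a|]; last exact: nbhs_None.
  apply: (nbhs_Some (U := fun b => `|b - a| < eps)).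
  by apply: filterS (@nbhsx_ballx _ R^o a _ eps0) => b; rewrite /ball/= distrC.
have [q [v [Vv v0 ->]] hq] := closure_ptws_approx hp hU.
exists v; split => // e; have := hq e; rewrite /U /embed => h.
  by move=> a pe; rewrite pe in h.
move=> pe; rewrite pe /= ger0_norm// in h.
by apply: le_lt_trans h; rewrite le_max lexx.
Qed.

(** The image of [V] in R^G is closed, so the finite coordinates of a limit point are attained by a
    vector of [V]; the section then corrects an approximating vector by a bounded amount, which
    keeps its large coordinates large. Conversely, non-negative lifts with thresholds n converge to
    [p]. *)
Lemma tnn_schubertP V p : is_subspace V ->
  tnn_schubert V p <-> nonneg_pt p /\ lifts V p.
Proof.
move=> hV; split=> [hp|[p0 pl]].
  split.
    move=> e a pe; rewrite leNgt; apply/negP => a0.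
    have na0 : 0 < - a by rewrite oppr_gt0.
    have [v [_ v0 va _]] := tnn_approx hp 0 na0.
    by have := va _ _ pe; have := v0 e; rewrite ltr_norml; lra.
  pose ph e : R := odflt 0 (p e : option R).
  pose G := finset (fun e => isSome (p e : option R)).
  have phG e : e \in G -> p e = Some (ph e).
    by rewrite inE /ph; case: (p e).
  have phN e : p e = None -> e \notin G by rewrite inE => ->.
  have [t [tV tG]] := section_exists G hV.
  pose T (w : E -> R) e := \sum_(i in G) w i * t i e.
  (* [C - 1] bounds the operator norm of [T] for the sup norm on [G]; the added 1 makes [C]
     invertible. *)
  pose C := 1 + \sum_e \sum_i `|t i e|.
  have C1 : 1 <= C by rewrite lerDl; do 2 (apply: sumr_ge0 => ? _).
  have TC w eps e : (forall i, i \in G -> `|w i| <= eps) -> 0 <= eps ->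
      `|T w e| <= eps * (C - 1).
    move=> hw eps0; apply: le_trans (ler_norm_sum _ _ _) _.
    apply: (@le_trans _ _ (\sum_i eps * `|t i e|)).
      rewrite [leRHS](bigID (mem G))/= -[leLHS]addr0; apply: lerD; last first.
        by apply: sumr_ge0 => i _; apply: mulr_ge0.
      by apply: ler_sum => i iG; rewrite normrM ler_wpM2r// hw.
    have -> : C - 1 = \sum_e \sum_i `|t i e| by rewrite /C addrAC subrr add0r.
    rewrite -mulr_sumr ler_wpM2l// [leRHS](bigD1 e)//= lerDl.
    by do 2 (apply: sumr_ge0 => ? _).
  have TB u v e : T (fun e => u e - v e) e = T u e - T v e.
    by rewrite /T -sumrB; apply: eq_bigr => i _; rewrite mulrBl.
  have Tph e : e \in G -> T ph e = ph e.
    move=> eG; apply/eqP; rewrite -subr_eq0 -normr_le0 leNgt; apply/negP => d0.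
    (* [T - id] kills [V] on [G]. Approximating [ph] within d / 2C therefore bounds the defect [d]
       by d / 2, a contradiction. *)
    set d := `|_| in d0; have eps0 : 0 < d / (C + C) by rewrite divr_gt0//; lra.
    have [v [Vv _ va _]] := tnn_approx hp 0 eps0.
    have hw i : i \in G -> `|ph i - v i| <= d / (C + C).
      by move=> iG; rewrite distrC ltW// (va _ _ (phG _ iG)).
    have h1 := TC _ _ e hw (ltW eps0); rewrite TB /T [in X in `|_ - X|]tG// in h1.
    have h2 := hw _ eG.
    have h3 : d <= d / (C + C) * (C - 1) + d / (C + C).
      rewrite {1}(_ : d = `|(T ph e - v e) - (ph e - v e)|); last by congr `|_|; ring.
      by apply: le_trans (ler_normB _ _) _; exact: lerD.
    have : d / (C + C) * (C - 1) + d / (C + C) = d / 2 by field; lra.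
    lra.
  move=> M.
  (* With precision 1 / C the correction is at most 1 - 1 / C < 1, so the threshold M + 1 leaves
     more than M. *)
  have eps0 : 0 < C^-1 by rewrite invr_gt0; lra.
  have [v [Vv _ va vN]] := tnn_approx hp (M + 1) eps0.
  have hw i : i \in G -> `|v i - ph i| <= C^-1.
    by move=> iG; rewrite ltW// (va _ _ (phG _ iG)).
  exists (fun e => v e - (T v e - T ph e)); split.
  - by do 2 (apply: subspaceB => //); exact: subspace_sum.
  - move=> e a pe; have eG : e \in G by rewrite inE pe.
    by rewrite (Tph _ eG) /T tG// /ph pe /=; ring.
  - move=> e pe; have := vN e pe; rewrite -TB.
    have := TC _ _ e hw (ltW eps0).
    have -> : C^-1 * (C - 1) = 1 - C^-1 by field; lra.
    rewrite ler_norml; lra.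
pose v n := proj1_sig (cid (pl n%:R)).
have vP n : [/\ V (v n), (forall e a, p e = Some a -> v n e = a)
    & (forall e, p e = None -> n%:R < v n e)] := proj2_sig (cid (pl n%:R)).
apply: (@closure_seq _ _ (fun n => embed (v n))) => [n|].
  have [Vv va vN] := vP n; exists (v n); split => // e.
  case pe: (p e) => [a|]; first by rewrite (va _ _ pe); exact: p0 pe.
  by apply: ltW; apply: le_lt_trans (vN _ pe).
apply: cvg_ptws => e; rewrite /embed; case pe: (p e) => [a|].
  rewrite (_ : (fun n => Some (v n e)) = fun=> Some a); first exact: cvg_cst.
  by apply/funext => n; have [_ va _] := vP n; rewrite (va _ _ pe).
by apply: cvg_None_nat => n; have [_ _] := vP n; exact.
Qed.

Lemma tnn_closed V : closed (tnn_schubert V).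
Proof. exact: closed_closure. Qed.

Lemma acyclic_flatI V F : (exists v, [/\ V v, (forall e, e \in F -> v e = 0)
  & (forall e, e \notin F -> 0 < v e)]) -> is_acyclic_flat V F.
Proof.
move=> [v [Vv v0 v1]]; split; exists v => //; split=> // e.
have [eF|eF] := boolP (e \in F); first by rewrite v0// eqxx.
by apply: gt_eqF; exact: v1.
Qed.

Lemma stratum_some F G S p e : stratum F G S p -> e \in G -> exists a, p e = Some a.
Proof.
move=> /(_ e)[h0 h1 h2] eG; have [/h0|eF] := boolP (e \in F); first by exists 0.
have : e \in G :\: F by rewrite inE eF.
by move/h1 => [r [_ ?]]; exists r.
Qed.

Lemma cellP V F G p : is_subspace V -> F \subset G ->
  Y_tnn_cell V F G p <-> stratum F G [set r | 0 < r] p /\ lifts V p.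
Proof.
move=> hV FG; split=> [[/(tnn_schubertP _ hV)[_ pl] ps]//|[ps pl]]; split=> //.
apply/(tnn_schubertP _ hV); split=> // e a pe; have [h0 h1 h2] := ps e.
have [eF|eF] := boolP (e \in F); first by have := h0 eF; rewrite pe => -[->].
have [eG|/h2] := boolP (e \in G); last by rewrite pe.
have [|r [/= r0]] := h1; first by rewrite inE eF.
by rewrite pe => -[->]; exact: ltW.
Qed.

Lemma cell_lift V F G p : is_subspace V -> F \subset G -> Y_tnn_cell V F G p ->
  forall M : R, exists v, [/\ V v, p = chart G v, (forall e, e \in F -> v e = 0),
    (forall e, e \notin F -> 0 < v e) & (forall e, e \notin G -> M < v e)].
Proof.
(* The threshold is at least 0 so that the lift is positive at the infinite coordinates even for
   negative [M]. *)
move=> hV FG /(cellP _ hV FG)[ps pl] M; have [v [Vv va vN]] := pl (Num.max M 0).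
have vG e : e \notin G -> Num.max M 0 < v e by have [_ _ /[apply] h] := ps e; exact: vN.
exists v; split=> //.
- apply/funext => e; rewrite /chart; case: ifPn => eG; last by have [_ _ ->] := ps e.
  by have [a pe] := stratum_some ps eG; rewrite (va _ _ pe).
- by move=> e eF; apply: va; have [->] := ps e.
- move=> e eF; have [eG|/vG] := boolP (e \in G); last by rewrite gt_max => /andP[].
  have [_ h _] := ps e; have [|r [/= r0 pe]] := h; first by rewrite inE eF.
  by rewrite (va _ _ pe).
- by move=> e /vG; rewrite gt_max => /andP[].
Qed.

Lemma cell_acyclic V F G p : is_subspace V -> F \subset G -> Y_tnn_cell V F G p ->
  is_acyclic_flat V F /\ is_acyclic_flat V G.
Proof.
move=> hV FG cp; have [v [Vv pv v0 v1 _]] := cell_lift hV FG cp 0.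
split; first by apply: acyclic_flatI; exists v.
have [M _ hM] := fin_bound v; have [w [Vw pw _ _ w1]] := cell_lift hV FG cp M.
apply: acyclic_flatI; exists (fun e => w e - v e); split.
- exact: subspaceB.
- move=> e eG; have := congr1 (fun f : PE R E => f e) (etrans (esym pv) pw).
  by rewrite /chart eG => -[->]; rewrite subrr.
- by move=> e /w1; rewrite subr_gt0; exact: le_lt_trans.
Qed.

Lemma chart_lifts V G x : is_subspace V -> is_acyclic_flat V G -> V x ->
  lifts V (chart G x).
Proof.
move=> hV [_ [k [Vk k0 k1]]] Vx M.
(* The witness [k] of acyclicity vanishes on [G] and is positive off it, so its multiples move only
   the infinite coordinates; using t + 1 makes the bound strict. *)
have [t _ ht] := fin_bound (fun e => (M - x e) / k e).
exists (fun e => (t + 1) * k e + x e); split.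
- exact: hV.2.
- by move=> e a; rewrite /chart; case: ifPn => // eG [<-]; rewrite k0// mulr0 add0r.
- move=> e; rewrite /chart; case: ifPn => // eG _.
  have ke := k1 _ eG; have := ht e; rewrite ler_pdivrMr//.
  by rewrite mulrDl mul1r; lra.
Qed.

Lemma chart_cell V F G x : is_subspace V -> F \subset G -> is_acyclic_flat V G ->
  V x -> (forall e, e \in F -> x e = 0) -> (forall e, e \in G :\: F -> 0 < x e) ->
  Y_tnn_cell V F G (chart G x).
Proof.
move=> hV FG aG Vx x0 x1; apply/(cellP _ hV FG); split; last exact: chart_lifts.
move=> e; rewrite /chart; split.
- by move=> eF; rewrite (fintype.subsetP FG)// x0.
- move=> eGF; exists (x e); split; first exact: x1.
  by move: eGF; rewrite inE => /andP[_ ->].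
- by move=> /negbTE ->.
Qed.

Lemma cell_nonempty V F G : is_subspace V -> F \subset G ->
  Y_tnn_cell V F G !=set0 <-> is_acyclic_flat V F /\ is_acyclic_flat V G.
Proof.
move=> hV FG; split=> [[p]|[[_ [v [Vv v0 v1]]] aG]]; first exact: cell_acyclic.
exists (chart G v); apply: chart_cell => // e; rewrite inE => /andP[eF _]; exact: v1.
Qed.

Lemma tnn_in_cell V p : is_subspace V -> tnn_schubert V p ->
  let F := finset (fun e => (p e : option R) == Some 0) in
  let G := finset (fun e => isSome (p e : option R)) in
  F \subset G /\ Y_tnn_cell V F G p.
Proof.
move=> hV hp F G; split; first by apply/fintype.subsetP => e; rewrite !inE => /eqP ->.
split=> // e; have /(tnn_schubertP _ hV)[p0 _] := hp.
split; rewrite !inE; first by move/eqP.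
- case pe : (p e) => [a|] //; rewrite andbT => a0; exists a; split=> //.
  have := p0 _ _ pe; rewrite le_eqVlt => /orP[/eqP a0'|//].
  by move: a0; rewrite -a0' eqxx.
- by case: (p e).
Qed.

(** The right side is closed and contains the cell. Conversely, lifts of [p] with growing
    thresholds, perturbed by a vanishing multiple of the positive witness of [F], have charts in the
    cell that converge to [p]. *)
Lemma closed_cellP V F G : is_subspace V -> F \subset G ->
  is_acyclic_flat V F -> is_acyclic_flat V G ->
  Y_tnn_closed_cell V F G = [set p | [/\ tnn_schubert V p,
    forall e, e \in F -> p e = Some 0 & forall e, e \notin G -> p e = None]].
Proof.
move=> hV FG [_ [v [Vv v0 v1]]] aG; apply/seteqP; split=> p /=.
  rewrite /Y_tnn_closed_cell => hp; split.
  - by apply: (@tnn_closed V p); apply: (closureS _ hp) => q [].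
  - move=> e eF.
    have cl : closed [set q : PE R E | q e = Some 0].
      apply: (@closed_comp _ _ (fun q : PE R E => q e) [set (Some 0 : P1 R)]).
        by move=> x _; exact: continuous_coord.
      exact: P1_closed1.
    by apply: cl; apply: (closureS _ hp) => q [_ /(_ e)[h _ _]]; exact: h.
  - move=> e eG.
    have cl : closed [set q : PE R E | q e = None].
      apply: (@closed_comp _ _ (fun q : PE R E => q e) [set (None : P1 R)]).
        by move=> x _; exact: continuous_coord.
      exact: P1_closed1.
    by apply: cl; apply: (closureS _ hp) => q [_ /(_ e)[_ _ h]]; exact: h.
move=> [/(tnn_schubertP _ hV)[p0 pl] pF pG].
pose w n := proj1_sig (cid (pl n%:R)).
have wP n : [/\ V (w n), (forall e a, p e = Some a -> w n e = a)
    & (forall e, p e = None -> n%:R < w n e)] := proj2_sig (cid (pl n%:R)).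
have w0 n e : 0 <= w n e.
  have [_ wa wN] := wP n; case pe : (p e) => [a|]; first by rewrite (wa _ _ pe); exact: p0 pe.
  by apply: ltW; apply: le_lt_trans (wN _ pe).
have n0 n : 0 < n.+1%:R :> R by rewrite ltr0n.
(* The perturbation makes the zero coordinates of [p] outside [F] positive and leaves those in [F]
   at zero. *)
pose u n e := n.+1%:R^-1 * v e + w n e.
apply: (@closure_seq _ _ (fun n => chart G (u n))) => [n|].
  have [Vw wa wN] := wP n; apply: chart_cell => //.
  - exact: hV.2.
  - by move=> e eF; rewrite /u (v0 e eF) mulr0 add0r; apply: wa; exact: pF.
  - move=> e; rewrite inE => /andP[eF _]; rewrite /u ltr_pwDl//.
    by rewrite mulr_gt0 ?invr_gt0//; exact: v1.
apply: cvg_ptws => e; rewrite /chart.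
have [eG|eG] := boolP (e \in G); last first.
  by rewrite pG//; exact: cvg_cst.
case pe: (p e) => [a|].
  have h := @cvg_shrink a (v e).
  rewrite (_ : (fun n => Some (u n e)) = fun n => Some (a + v e / n.+1%:R)); last first.
    apply/funext => n; rewrite /u; have [_ wa _] := wP n.
    by rewrite (wa _ _ pe) addrC mulrC.
  by move=> U /h.
apply: cvg_None_nat => n; rewrite /u; have [_ _ wN] := wP n.
apply: lt_le_trans (wN _ pe) _; rewrite lerDr mulr_ge0 ?invr_ge0 ?(ltW (n0 _))//.
have [eF|eF] := boolP (e \in F); first by rewrite v0.
by rewrite ltW// v1.
Qed.

Lemma stratum_sets F G p : F \subset G -> stratum F G [set r | 0 < r] p ->
  F = finset (fun e => (p e : option R) == Some 0) /\
  G = finset (fun e => isSome (p e : option R)).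
Proof.
move=> FG ps; split; apply/setP => e; rewrite inE; have [h0 h1 h2] := ps e.
  have [/h0 ->|eF] := boolP (e \in F); first by rewrite eqxx.
  have [eG|/h2 ->//] := boolP (e \in G).
  have [|r [/= r0 ->]] := h1; first by rewrite inE eF.
  by apply/esym/eqP => -[r0']; rewrite r0' ltxx in r0.
have [eG|/h2 ->//] := boolP (e \in G).
by have [a ->] := stratum_some ps eG.
Qed.

Lemma stratum_subset F G S p : stratum F G S p -> F \subset G.
Proof.
move=> ps; apply/fintype.subsetP => e eF; have [h0 _ h2] := ps e.
by apply: contraT => /h2; rewrite h0.
Qed.

Lemma closed_cell_decomp V F G : is_subspace V -> F \subset G ->
  Y_tnn_cell V F G !=set0 -> Y_tnn_closed_cell V F G =
       [set p | exists F' G' : {set E},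
          sub_pair V F G F' G' /\ Y_tnn_cell V F' G' p].
Proof.
move=> hV FG /(cell_nonempty hV FG)[aF aG]; rewrite closed_cellP//.
apply/seteqP; split=> p /=.
  move=> [hp pF pG]; have [FG' cp] := tnn_in_cell hV hp.
  have [aF' aG'] := cell_acyclic hV FG' cp.
  eexists; eexists; split; last exact: cp.
  split=> //; apply/fintype.subsetP => e; rewrite inE; first by move=> /pF ->.
  by move=> pe; apply: contraLR pe => /pG ->.
move=> [F' [G' [[FF' FG' GG' aF' aG'] [hp ps]]]]; split=> //.
  by move=> e eF; have [->] := ps e => //; exact: (fintype.subsetP FF').
move=> e eG; have [_ _ ->//] := ps e.
by apply: contraNN eG; exact: (fintype.subsetP GG').
Qed.

(** A point of a stratum forces F to lie in G and determines both sets, as its zero and its finite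
    coordinates. *)
Lemma cells_disjoint V F1 G1 F2 G2 : (F1, G1) <> (F2, G2) ->
  Y_tnn_cell V F1 G1 `&` Y_tnn_cell V F2 G2 = set0.
Proof.
move=> ne; rewrite -subset0 => p [[_ h1] [_ h2]]; apply: ne.
have [-> ->] := stratum_sets (stratum_subset h1) h1.
by have [-> ->] := stratum_sets (stratum_subset h2) h2.
Qed.

End Lifts.

(** * The algebraic strata *)

Section AlgebraicCells.
Variables (R : realType) (E : finType).
Implicit Types (V W : set (E -> R)) (F G H : {set E}) (p q : PE R E).

Lemma cvg_inv_nat (u : nat -> R) : (forall n, n%:R < u n) ->
  (fun n => (u n)^-1) @ \oo --> (0 : R).
Proof.
move=> h; apply/(@cvgrPdist_lt _ R^o) => e e0; near=> n.
have u0 : 0 < u n by apply: le_lt_trans (h n).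
rewrite sub0r normrN gtr0_norm ?invr_gt0// invf_plt ?posrE//.
by apply: lt_trans (h n); near: n; exact: nbhs_infty_gtr.
Unshelve. all: by end_near. Qed.

(* Near infinity the homogeneous coordinates [v : 1] are rescaled to [1 : 1/v]. *)
Lemma tnn_sub_schubert V p : is_subspace V -> tnn_schubert V p -> schubert V p.
Proof.
move=> hV /(tnn_schubertP _ hV)[p0 pl] d f fd fV.
pose v n := proj1_sig (cid (pl n%:R)).
have vP n : [/\ V (v n), (forall e a, p e = Some a -> v n e = a)
    & (forall e, p e = None -> n%:R < v n e)] := proj2_sig (cid (pl n%:R)).
pose z n : {ptws (E + E)%type -> R} := fun i => match i with
  | inl e => if p e is Some a then a else 1
  | inr e => if p e is Some a then 1 else (v n e)^-1 end.
have zf n : peval f (z n) = 0.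
  have [Vv va vN] := vP n.
  have := fV (embed (v n)) (ex_intro _ _ (conj Vv erefl)).
  (* The factor by which multihomogeneity of degree [d] changes the value when the infinite factors
     are rescaled. *)
  pose K := \prod_(e | p e == None) v n e ^+ d e.
  have v0 e : p e = None -> v n e != 0.
    by move=> pe; apply: lt0r_neq0; apply: le_lt_trans (vN _ pe).
  have K0 : K != 0 by apply/prodf_neq0 => e /eqP; move=> /v0; exact: expf_neq0.
  suff -> : hom_eval f (embed (v n)) = K * peval f (z n).
    by move/eqP; rewrite mulf_eq0 (negbTE K0) => /eqP.
  rewrite /hom_eval /peval mulr_sumr; apply: eq_big_seq => t tf.
  rewrite mulrCA; congr (_ * _); rewrite !big_sumType /= /K.
  rewrite (big_mkcond (fun e => p e == None)) /= -!big_split; apply: eq_bigr => e _ /=.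
  have := allP fd _ tf => /forallP/(_ e)/eqP <-.
  case pe : (p e) => [a|] /=; first by rewrite (va _ _ pe) mul1r.
  by rewrite expr1n mulr1 expr1n mul1r exprD exprVn mulfK// expf_neq0// v0.
pose z0 : {ptws (E + E)%type -> R} := fun i => match i with
  | inl e => (hcoord (p e)).1 | inr e => (hcoord (p e)).2 end.
have zz0 : z @ \oo --> z0.
  apply: cvg_ptws => -[] e; rewrite /z /z0; case pe : (p e) => [a|] /=;
    try exact: cvg_cst.
  by apply: cvg_inv_nat => n; have [_ _ h] := vP n; exact: h.
rewrite /hom_eval -/z0.
have h : (fun n => peval f (z n)) @ \oo --> peval f z0.
  apply: (@cvg_comp _ _ _ z (fun x : {ptws (E + E)%type -> R} => peval f x) _ _ _ zz0).
  exact: continuous_peval.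
have h0 : (fun n => peval f (z n)) @ \oo --> (0 : R).
  by rewrite (_ : (fun n => _) = fun=> 0); [exact: cvg_cst|apply/funext].
by apply: (cvg_unique _ h h0).
Qed.

Lemma peval_map (I : finType) (J : Type) (r : seq J) (c : J -> R) (m : J -> I -> nat)
    (x : I -> R) :
  peval [seq (c j, m j) | j <- r] x = \sum_(j <- r) c j * \prod_i x i ^+ m j i.
Proof. by rewrite /peval big_map. Qed.

(** For each e in [G], the linear relation saying that the section reproduces v_e holds on [V].
    Homogenised, with degree 1 in every factor indexed by [G] and 0 elsewhere, it also holds at [p],
    whose coordinates on [G] are therefore those of a vector of [V]. *)
Lemma schubert_chart V G p : is_subspace V -> schubert V p ->
  (forall e, e \in G -> p e <> None) -> (forall e, e \notin G -> p e = None) ->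
  exists2 x, V x & p = chart G x.
Proof.
move=> hV hp pG pN.
pose ph e : R := odflt 0 (p e : option R).
have phG e : e \in G -> p e = Some (ph e).
  by move=> /pG; rewrite /ph; case: (p e).
have [t [tV tG]] := section_exists G hV.
exists (fun e => \sum_(i in G) ph i * t i e); first exact: subspace_sum.
apply/funext => e; rewrite /chart; case: ifPn => [eG|/pN//].
rewrite phG//; congr Some; apply/eqP; rewrite eq_sym -subr_eq0; apply/eqP.
(* The monomial x_i times the product of the y_j over j in [G] other than i. *)
pose m (i : E) (k : (E + E)%type) : nat :=
  match k with inl j => (j == i) | inr j => (j \in G) && (j != i) end.
pose f : polyf R (E + E)%type :=
  [seq (t i e - (i == e)%:R, m i) | i <- enum (mem G)].
have fE q : (forall i, i \in G -> (hcoord (q i)).2 = 1) ->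
    hom_eval f q = \sum_(i in G) (hcoord (q i)).1 * t i e - (hcoord (q e)).1.
  move=> q1; rewrite /hom_eval peval_map big_enum /=.
  transitivity (\sum_(i in G) (t i e - (i == e)%:R) * (hcoord (q i)).1).
    apply: eq_bigr => i iG; congr (_ * _); rewrite big_sumType /=.
    rewrite [X in _ * X]big1 ?mulr1.
      rewrite (bigD1 i)//= eqxx expr1 big1 ?mulr1// => j ji.
      by rewrite (negbTE ji) expr0.
    move=> j _; have [jG|jG] := boolP (j \in G); last by rewrite expr0.
    by rewrite q1// expr1n.
  rewrite (eq_bigr (fun i => (hcoord (q i)).1 * t i e - (i == e)%:R * (hcoord (q i)).1));
    last by move=> i _; ring.
  rewrite sumrB; congr (_ - _); rewrite (bigD1 e)//= eqxx mul1r big1 ?addr0//.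
  by move=> i /andP[_ /negbTE ->]; rewrite mul0r.
have := hp (fun i => (i \in G : nat)) f.
rewrite fE; last by move=> i iG; rewrite phG.
have hph : \sum_(i in G) (hcoord (p i)).1 * t i e - (hcoord (p e)).1 =
    \sum_(i in G) ph i * t i e - ph e.
  by rewrite (phG e)//=; congr (_ - _); apply: eq_bigr => i iG; rewrite phG.
rewrite hph; apply.
  apply/allP => u /mapP[i]; rewrite mem_enum => iG ->; apply/forallP => j /=.
  by have [->|] := eqVneq j i; [rewrite iG|rewrite andbT].
by move=> q [u [Vu ->]]; rewrite fE//= tG// subrr.
Qed.

Lemma tnn_sub_alg_cell V F G : is_subspace V -> Y_tnn_cell V F G `<=` Y_alg_cell V F G.
Proof.
move=> hV p [hp ps]; split; first exact: tnn_sub_schubert.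
move=> e; have [h0 h1 h2] := ps e; split=> // /h1[r [/= r0 ->]].
by exists r; split=> //=; exact: lt0r_neq0.
Qed.

Lemma alg_cell_pos V F G p : is_subspace V -> F \subset G -> is_acyclic_flat V G ->
  Y_alg_cell V F G p ->
  (forall e, e \in G :\: F -> exists2 r, 0 < r & p e = Some r) -> Y_tnn_cell V F G p.
Proof.
move=> hV FG aG [hp ps] ppos.
have [||x Vx px] := @schubert_chart V G p hV hp.
- by move=> e eG; have [a ->] := stratum_some ps eG.
- by move=> e eG; have [_ _ ->] := ps e.
rewrite px; apply: chart_cell => // e.
  move=> eF; have [+ _ _] := ps e => /(_ eF); rewrite px /chart.
  by rewrite (fintype.subsetP FG)// => -[].
move=> eGF; have [r r0] := ppos _ eGF; rewrite px /chart.
by move: eGF; rewrite inE => /andP[_ ->] [->].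
Qed.

Lemma chart_continuous (X : topologicalType) G (f : X -> E -> R) :
  (forall e, continuous (fun x => f x e)) -> continuous (fun x => chart G (f x)).
Proof.
move=> cf; apply: continuous_ptws => e; rewrite /chart.
have [eG|eG] := boolP (e \in G); last by move=> x; exact: cvg_cst.
by move=> x U /= /(cf e x).
Qed.

(** Coordinates in [G :\: F] never vanish on the algebraic cell, so being positive is open and
    closed there and a connected set through [p] stays positive. Conversely, the segment between
    lifts of two points of the cell stays in it. *)
Lemma cell_component V F G p : is_subspace V -> F \subset G -> Y_tnn_cell V F G p ->
  connected_component (Y_alg_cell V F G) p = Y_tnn_cell V F G.
Proof.
move=> hV FG cp; have [aF aG] := cell_acyclic hV FG cp.
apply/seteqP; split=> q.
  move=> [C [Cp CY cC] Cq]; apply: alg_cell_pos => //; first exact: CY.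
  move=> e eGF.
  pose pos : set (PE R E) := (fun q : PE R E => q e) @^-1` (Some @` [set r | 0 < r]).
  pose neg : set (PE R E) := (fun q : PE R E => q e) @^-1` (Some @` [set r | r < 0]).
  have opos : open pos.
    apply: open_comp; first by move=> x _; exact: continuous_coord.
    by apply: one_point_compactification_open_some; exact: open_gt.
  have oneg : open neg.
    apply: open_comp; first by move=> x _; exact: continuous_coord.
    by apply: one_point_compactification_open_some; exact: open_lt.
  suff : (C `&` pos) q by case=> _ [r r0 qe]; exists r.
  have -> // : C `&` pos = C.
  apply: cC.
  - exists p; split=> //; have [_ /(_ e)[_ /(_ eGF)[r [r0 pe]] _]] := cp.
    by exists r.
  - by exists pos.
  - exists (~` neg); first exact: open_closedC.
    apply/seteqP; split=> x [Cx xe]; split=> //.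
      move: xe => [r /= r0 xe] [s /= s0]; rewrite -xe => -[sr]; move: s0; rewrite sr; lra.
    have [_ /(_ e)[_ /(_ eGF)[r [/= r0 xr]] _]] := CY _ Cx.
    exists r => //=; rewrite lt_neqAle eq_sym r0 leNgt; apply/negP => r1.
    by apply: xe; exists r.
move=> cq.
have [x [Vx px x0 x1 _]] := cell_lift hV FG cp 0.
have [y [Vy qy y0 y1 _]] := cell_lift hV FG cq 0.
pose f (s : R) : PE R E := chart G (fun e => (1 - s) * x e + s * y e).
have cf : continuous f.
  apply: chart_continuous => e; apply: continuousDr; apply: continuousMr.
  - by apply: continuousBr; [exact: continuous_cstr|move=> ?; exact: cvg_id].
  - exact: continuous_cstr.
  - by move=> ?; exact: cvg_id.
  - exact: continuous_cstr.
have f0 : f 0 = p.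
  by rewrite px /f; congr chart; apply/funext => e; rewrite subr0 mul1r mul0r addr0.
have f1 : f 1 = q.
  by rewrite qy /f; congr chart; apply/funext => e; rewrite subrr mul1r mul0r add0r.
exists (f @` `[0, 1]%classic).
  split.
  - by exists 0 => //=; rewrite in_itv /= lexx ler01.
  - move=> z [s /=]; rewrite in_itv /= => /andP[s0 s1] <-.
    apply: tnn_sub_alg_cell => //; apply: chart_cell => //.
    + by apply: hV.2 => //; exact: subspaceZ.
    + by move=> e eF; rewrite x0// y0//; ring.
    + move=> e; rewrite inE => /andP[eF _]; have := x1 _ eF; have := y1 _ eF => y1' x1'.
      have [->|s00] := eqVneq s 0; first by rewrite subr0 mul1r mul0r addr0.
      have : 0 < s by rewrite lt_neqAle eq_sym s00.
      by move=> s0'; apply: ltr_wpDl; [rewrite mulr_ge0// ?subr_ge0// ltW|rewrite mulr_gt0].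
  - apply: connected_continuous_connected; first exact: segment_connected.
    exact: continuous_subspaceT.
by exists 1 => //=; rewrite in_itv /= lexx ler01.
Qed.

End AlgebraicCells.

(** * Semialgebraic charts of the open cells *)

Section PolynomialFunctions.
Variables (R : realType) (I : finType).
Implicit Types (g h : (I -> R) -> R) (A B : set (I -> R)).

Definition polyfun g := exists f : polyf R I, forall x, peval f x = g x.

Lemma polyfun_cst c : polyfun (fun=> c).
Proof.
exists [:: (c, fun=> 0%N)] => x; rewrite /peval big_seq1 big1 ?mulr1// => i _.
Qed.

Lemma polyfun_var i : polyfun (fun x => x i).
Proof.
exists [:: (1, fun j => (j == i) : nat)] => x.
rewrite /peval big_seq1 mul1r (bigD1 i)//= eqxx expr1 big1 ?mulr1// => j ji.
by rewrite (negbTE ji) expr0.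
Qed.

Lemma polyfunD g h : polyfun g -> polyfun h -> polyfun (fun x => g x + h x).
Proof.
by move=> [f fg] [k kh]; exists (f ++ k) => x; rewrite /peval big_cat -fg -kh.
Qed.

Lemma polyfunM g h : polyfun g -> polyfun h -> polyfun (fun x => g x * h x).
Proof.
move=> [f fg] [k kh].
exists [seq (s.1 * t.1, fun i => (s.2 i + t.2 i)%N) | s <- f, t <- k] => x.
rewrite -fg -kh /peval big_allpairs_dep /= mulr_suml; apply: eq_bigr => s _.
rewrite mulr_sumr; apply: eq_bigr => t _.
under eq_bigr do rewrite exprD.
by rewrite big_split /=; ring.
Qed.

Lemma polyfunB g h : polyfun g -> polyfun h -> polyfun (fun x => g x - h x).
Proof.
move=> pg ph; have [f fE] := polyfunD pg (polyfunM (polyfun_cst (-1)) ph).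
by exists f => x; rewrite fE mulN1r.
Qed.

Lemma polyfunX g n : polyfun g -> polyfun (fun x => g x ^+ n).
Proof.
move=> pg; elim: n => [|n IH]; first exact: polyfun_cst.
by under [fun x => _]funext do rewrite exprS; exact: polyfunM.
Qed.

Lemma polyfun_sum (J : Type) (r : seq J) (P : pred J) (g : J -> (I -> R) -> R) :
  (forall j, polyfun (g j)) -> polyfun (fun x => \sum_(j <- r | P j) g j x).
Proof.
move=> pg; elim: r => [|j r IH].
  by under [fun x => _]funext do rewrite big_nil; exact: polyfun_cst.
by under [fun x => _]funext do rewrite big_cons; case: (P j) => //; exact: polyfunD.
Qed.

Lemma polyfun_prod (J : Type) (r : seq J) (P : pred J) (g : J -> (I -> R) -> R) :
  (forall j, polyfun (g j)) -> polyfun (fun x => \prod_(j <- r | P j) g j x).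
Proof.
move=> pg; elim: r => [|j r IH].
  by under [fun x => _]funext do rewrite big_nil; exact: polyfun_cst.
by under [fun x => _]funext do rewrite big_cons; case: (P j) => //; exact: polyfunM.
Qed.

Lemma semialg_gt0 g : polyfun g -> semialg [set x | 0 < g x].
Proof. by move=> [f /funext <-]; exact: semialg_pos. Qed.

Lemma semialg_eq0 g : polyfun g -> semialg [set x | g x = 0].
Proof. by move=> [f /funext <-]; exact: semialg_zero. Qed.

Lemma semialgI A B : semialg A -> semialg B -> semialg (A `&` B).
Proof.
move=> sA sB; rewrite -[_ `&` _]setCK setCI.
by apply: semialg_compl; apply: semialg_union; exact: semialg_compl.
Qed.

Lemma semialgT : semialg [set: I -> R].
Proof.
have := semialg_gt0 (polyfun_cst 1); congr semialg; apply/seteqP; split=> // x _.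
exact: ltr01.
Qed.

Lemma semialg_eq g h : polyfun g -> polyfun h -> semialg [set x | g x = h x].
Proof.
move=> pg ph; have := semialg_eq0 (polyfunB pg ph).
congr semialg; apply/seteqP; split=> x /=; first by move/eqP; rewrite subr_eq0 => /eqP.
by move=> ->; rewrite subrr.
Qed.

Lemma semialg_le g h : polyfun g -> polyfun h -> semialg [set x | g x <= h x].
Proof.
move=> pg ph; have := semialg_compl (semialg_gt0 (polyfunB pg ph)).
congr semialg; apply/seteqP; split=> x /=; rewrite subr_gt0 leNgt; first by move/negP.
by move=> /negP.
Qed.

Lemma semialg_imply (b : bool) A : semialg A -> semialg [set x | b -> A x].
Proof.
move=> sA; case: b.
  by move: sA; congr semialg; apply/seteqP; split=> x //= h; exact: h.
by have := semialgT; congr semialg; apply/seteqP; split.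
Qed.

Lemma semialg_forall (J : finType) (A : J -> set (I -> R)) :
  (forall j, semialg (A j)) -> semialg [set x | forall j, A j x].
Proof.
move=> sA.
suff main (s : seq J) : semialg [set x | forall j, j \in s -> A j x].
  have := main (enum J); congr semialg; apply/seteqP; split=> x /= h j => [|_].
    by apply: h; rewrite mem_enum.
  exact: h.
elim: s => [|j s IH].
  by have := semialgT; congr semialg; apply/seteqP; split.
have := semialgI (sA j) IH; congr semialg; apply/seteqP; split=> x /=.
  by move=> [xj xs] i; rewrite inE => /orP[/eqP ->//|/xs].
by move=> h; split=> [|i si]; apply: h; rewrite inE ?eqxx// si orbT.
Qed.

Lemma semialg_exists (J : finType) (A : J -> set (I -> R)) :
  (forall j, semialg (A j)) -> semialg [set x | exists j, A j x].
Proof.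
move=> sA; have := semialg_compl (semialg_forall (fun j => semialg_compl (sA j))).
congr semialg; apply/seteqP; split=> x /=; first by move/existsNP => [j /contrapT]; exists j.
by move=> [j Ajx] /(_ j).
Qed.

End PolynomialFunctions.

Lemma polyfun_pullback (R : realType) (I J : finType) (phi : I -> J) g :
  @polyfun R I g -> polyfun (fun z : J -> R => g (fun i => z (phi i))).
Proof.
move=> [f /funext <-]; rewrite /peval; apply: polyfun_sum => t.
apply: polyfunM; first exact: polyfun_cst.
by apply: polyfun_prod => i; apply: polyfunX; exact: polyfun_var.
Qed.

Lemma semialg_pullback (R : realType) (I J : finType) (phi : I -> J) (A : set (I -> R)) :
  semialg A -> semialg [set z : J -> R | A (fun i => z (phi i))].
Proof.
have peP f : polyfun (fun x : I -> R => peval f x) by exists f.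
elim=> [f|f|B C _ hB _ hC|B _ hB].
- exact: semialg_gt0 (polyfun_pullback phi (peP f)).
- exact: semialg_eq0 (polyfun_pullback phi (peP f)).
- exact: semialg_union.
- exact: semialg_compl.
Qed.

(** * Minima over a finite set *)

Section FiniteMinimum.
Variables (R : realType) (E : finType).
Implicit Types (S : {set E}) (f : E -> R).

(** The default value [f e0] is one of the values being compared as soon as [e0] is in [S]. *)
Definition fmin S (e0 : E) f : R := \big[Num.min/f e0]_(e in S) f e.

(** Lower bound plus attainment: the form in which a minimum can enter a semialgebraic
    description. *)
Lemma fmin_eqP S e0 f s : e0 \in S ->
  fmin S e0 f = s <-> (forall e, e \in S -> s <= f e) /\ (exists2 e, e \in S & s = f e).
Proof.
move=> e0S.
have le e : e \in S -> fmin S e0 f <= f e by move=> eS; exact: bigmin_le_cond.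
have [e1 e1S he1] : exists2 e, e \in S & fmin S e0 f = f e.
  apply: (big_ind (fun x => exists2 e, e \in S & x = f e)) => [|x y [a aS ->] [b bS ->]|e eS]; [by exists e0| |by exists e].
  by rewrite minElt; case: ifP => _; [exists a|exists b].
split=> [<-|[sle [e eS se]]]; first by split=> //; exists e1.
by apply/eqP; rewrite eq_le {1}se le// he1 sle.
Qed.

Lemma fmin_continuous (X : topologicalType) S e0 (f : X -> E -> R) :
  (forall e, continuous (fun x => f x e)) -> continuous (fun x => fmin S e0 (f x)).
Proof.
move=> cf; rewrite /fmin.
elim: (index_enum E) => [|e r IH].
  by under [fun x => _]funext do rewrite big_nil; exact: cf.
under [fun x => _]funext do rewrite big_cons; case: (e \in S) => //.
by move=> x; apply: continuous_min; [exact: cf|exact: IH].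
Qed.

End FiniteMinimum.

Section OpenCellChart.
Variable R : realType.

(* The positive root [s] of [s - 1/s = t]: a semialgebraic bijection from R to R_{>0}. *)
Definition posroot (t : R) : R := (t + Num.sqrt (t ^+ 2 + 4)) / 2.

Lemma posrootP t s : 0 < s -> posroot t = s <-> s ^+ 2 - 1 = t * s.
Proof.
move=> s0; have d0 : 0 <= t ^+ 2 + 4 by rewrite addr_ge0// sqr_ge0.
have sq : Num.sqrt (t ^+ 2 + 4) ^+ 2 = t ^+ 2 + 4 by rewrite sqr_sqrtr.
split=> [<-|h]; rewrite /posroot.
  move: sq; set r := Num.sqrt _ => sq.
  have -> : ((t + r) / 2) ^+ 2 = (t ^+ 2 + 2 * t * r + r ^+ 2) / 4 by field.
  by rewrite sq; field.
have -> : t ^+ 2 + 4 = (2 * s - t) ^+ 2.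
  have : 4 * (s ^+ 2 - 1 - t * s) = 0 by rewrite h subrr mulr0.
  move=> h4; have -> : (2 * s - t) ^+ 2 = t ^+ 2 + 4 + 4 * (s ^+ 2 - 1 - t * s) by ring.
  by rewrite h4 addr0.
rewrite sqrtr_sqr ger0_norm; first by field.
have : 0 < (2 * s - t) * s.
  have -> : (2 * s - t) * s = 2 * s ^+ 2 - t * s by ring.
  by rewrite -h; have := sqr_ge0 s; lra.
by rewrite pmulr_lgt0// => /ltW.
Qed.

Lemma posroot_gt0 t : 0 < posroot t.
Proof.
rewrite /posroot divr_gt0//.
have : `|t| < Num.sqrt (t ^+ 2 + 4) by rewrite -sqrtr_sqr ltr_sqrt; have := sqr_ge0 t; lra.
by rewrite ltr_norml; lra.
Qed.

Lemma posroot_continuous : continuous posroot.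
Proof.
apply: continuousMr; last exact: continuous_cstr.
apply: continuousDr; first by move=> x; exact: cvg_id.
move=> x; apply: (@continuous_comp _ _ _ (fun t : R => t ^+ 2 + 4) Num.sqrt).
  apply: continuousDr; last exact: continuous_cstr.
  by apply: continuousXr => y; exact: cvg_id.
exact: sqrt_continuous.
Qed.

End OpenCellChart.

Section OpenCell.
Variables (R : realType) (E : finType) (V : set (E -> R)) (F G : {set E}).
Hypotheses (hV : is_subspace V) (FG : F \subset G)
  (aF : is_acyclic_flat V F) (aG : is_acyclic_flat V G).

Let A := [set x : {ptws E -> R} |
  (forall e, e \notin G -> x e = 0) /\ Y_tnn_cell V F G (chart G x)].

Variables (k : nat) (b beta : 'I_k -> E -> R).
Hypotheses (bV : forall j, vanish_on V F (b j))
  (bbeta : forall i j, \sum_(e in G) beta i e * b j e = (i == j)%:R)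
  (bspan : forall w, vanish_on V F w -> forall e, e \in G ->
         w e = \sum_j (\sum_(i in G) beta j i * w i) * b j e).

Let lam (x : E -> R) j := \sum_(i in G) beta j i * x i.

Lemma open_cellP x : A x <-> [/\ forall e, e \notin G -> x e = 0,
  forall e, e \in G :\: F -> 0 < x e & forall e, e \in G -> x e = \sum_j lam x j * b j e].
Proof.
split=> [[x0 cx]|[x0 x1 xl]].
  have [v [Vv xv v0 v1 _]] := cell_lift hV FG cx 0.
  have xvG e : e \in G -> x e = v e.
    by move=> eG; have := congr1 (fun f : PE R E => f e) xv; rewrite /chart eG => -[].
  split=> // e.
    by rewrite inE => /andP[eF eG]; rewrite xvG// v1.
  move=> eG; have vW : vanish_on V F v by [].
  rewrite xvG// (bspan vW eG); apply: eq_bigr => j _; congr (_ * _).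
  by apply: eq_bigr => i iG; rewrite xvG.
split=> //.
pose y e := \sum_j lam x j * b j e.
have -> : chart G x = chart G y.
  by apply/funext => e; rewrite /chart; case: ifPn => // eG; rewrite xl.
have [Vy y0] : vanish_on V F y.
  by apply: subspace_sum => //; exact: vanish_on_subspace.
apply: chart_cell => // e eGF; rewrite /y -xl; first exact: x1.
by move: eGF; rewrite inE => /andP[].
Qed.

Lemma open_cell_semialg : semialg A.
Proof.
have -> : A = [set x | forall e, e \notin G -> x e = 0] `&`
  ([set x | forall e, e \in G :\: F -> 0 < x e] `&`
   [set x | forall e, e \in G -> x e = \sum_j lam x j * b j e]).
  by apply/seteqP; split=> x; [move/open_cellP => [? ? ?]|move=> [? [? ?]]; apply/open_cellP].
apply: semialgI; last apply: semialgI.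
- apply: semialg_forall => e; apply: semialg_imply; apply: semialg_eq0; exact: polyfun_var.
- apply: semialg_forall => e; apply: semialg_imply; apply: semialg_gt0; exact: polyfun_var.
- apply: semialg_forall => e; apply: semialg_imply; apply: semialg_eq.
    exact: polyfun_var.
  apply: polyfun_sum => j; apply: polyfunM; last exact: polyfun_cst.
  apply: polyfun_sum => i; apply: polyfunM; [exact: polyfun_cst|exact: polyfun_var].
Qed.

(* If c is a positive vector of the cell, the cone is R_{>0} x (its span / c): the first
   factor is the minimum of x_e / c_e, and adding multiples of c only shifts it. *)
Lemma open_cell_homeo : exists h : {ptws E -> R} -> {ptws 'I_k -> R},
  homeo_on A (pos_orthant R k) h /\ semialg (graph_on A h).
Proof.
have [_ [c [Vc c0 c1]]] := aF.
have cW : vanish_on V F c by [].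
(* With no coordinates every vector of the span vanishes on [G]; positivity of [c] leaves no index
   in [G :\: F], and the cell is a point. *)
have [k0|k0] := posnP k.
  have ordF : 'I_k -> False by case=> i; rewrite [X in (_ < X)%N]k0.
  exists (fun _ _ => 0); split.
    exists (fun _ e => if e \in G then \sum_j lam c j * b j e else 0); split.
    - by move=> x _ /ordF.
    - move=> y _; apply/open_cellP; split=> e.
      + by move/negbTE ->.
      + rewrite inE => /andP[eF eG]; rewrite eG.
        by have := bspan cW eG; rewrite -/(lam c _) => <-; exact: c1.
      + by move=> ->; rewrite !big1// => j; case: (ordF j).
    - move=> x /open_cellP[x0 _ xl]; apply/funext => e.
      case: ifPn => eG; last by rewrite x0.
      by rewrite xl// !big1// => j; case: (ordF j).
    - by move=> y _; apply/funext => j; case: (ordF j).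
    - split; apply: continuous_subspaceT; first by apply: continuous_ptws => j; case: (ordF j).
      by apply: continuous_ptws => e; exact: continuous_cstr.
  have := semialg_pullback (@inl E 'I_k) open_cell_semialg.
  congr semialg; apply/seteqP; split=> z /=; last by case.
  by move=> Az; split=> //; apply/funext => j; case: (ordF j).
(* A coordinate in which [c] has a nonzero component: this is the one traded for the minimum. *)
have [j0 [e0 e0S gam0]] : exists j0, exists2 e0, e0 \in G :\: F & lam c j0 != 0.
  pose i0 := Ordinal k0.
  have [e eG be] : exists2 e, e \in G & b i0 e != 0.
    apply: contrapT => h; have := bbeta i0 i0; rewrite eqxx big1.
      by move/eqP; rewrite eq_sym oner_eq0.
    move=> e eG; suff -> : b i0 e = 0 by rewrite mulr0.
    by apply: contrapT => /eqP be; apply: h; exists e.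
  have eF : e \notin F by apply: contraNN be => eF; rewrite (bV i0).2.
  apply: contrapT => h; have := c1 _ eF; rewrite (bspan cW eG) big1 ?ltxx// => j _.
  rewrite -/(lam c j); have [->|lj] := eqVneq (lam c j) 0; first by rewrite mul0r.
  by exfalso; apply: h; exists j, e => //; rewrite inE eF.
set S := G :\: F in e0S.
have cS e : e \in S -> 0 < c e by rewrite inE => /andP[eF _]; exact: c1.
have SG e : e \in S -> e \in G by rewrite inE => /andP[].
pose gam j := lam c j.
pose m (x : E -> R) := fmin S e0 (fun e => x e / c e).
(* The coordinates of the representative of x modulo [c] whose [j0] coordinate is zero. *)
pose l (x : E -> R) j := lam x j - lam x j0 * (gam j / gam j0).
pose h (x : {ptws E -> R}) : {ptws 'I_k -> R} :=
  fun j => if j == j0 then m x else posroot (l x j).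
pose Y (s : 'I_k -> R) e := \sum_(j | j != j0) s j * b j e.
(* Takes the representative [Y s] and adds the multiple of [c] that brings its minimum to [s j0].
   The map [sig] below undoes [posroot]. *)
pose g2 (s : {ptws 'I_k -> R}) : {ptws E -> R} :=
  fun e => if e \in G then Y s e + (s j0 - m (Y s)) * c e else 0.
pose sig (s : {ptws 'I_k -> R}) : {ptws 'I_k -> R} :=
  fun j => if j == j0 then s j else s j - (s j)^-1.
have lamD u v a j : lam (fun e => u e + a * v e) j = lam u j + a * lam v j.
  by rewrite /lam mulr_sumr -big_split; apply: eq_bigr => i _ /=; ring.
have lamext u v j : {in G, u =1 v} -> lam u j = lam v j.
  by move=> uv; apply: eq_bigr => i iG; rewrite uv.
have lamY s j : lam (Y s) j = if j == j0 then 0 else s j.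
  rewrite /lam /Y; under eq_bigr do rewrite mulr_sumr.
  rewrite exchange_big /=.
  under eq_bigr => i _.
    under eq_bigr => e _ do rewrite mulrCA.
    rewrite -mulr_sumr bbeta; over.
  have [->|jj0] := eqVneq j j0.
    by rewrite big1// => i ij; rewrite eq_sym (negbTE ij) mulr0.
  rewrite (bigD1 j)//= eqxx mulr1 big1 ?addr0// => i /andP[_ ij].
  by rewrite eq_sym (negbTE ij) mulr0.
have mshift u a : m (fun e => u e + a * c e) = m u + a.
  have [ule [e1 e1S eu]] := (fmin_eqP (fun e => u e / c e) (m u) e0S).1 erefl.
  apply/(fmin_eqP _ _ e0S); split=> [e eS|].
    by have ce := cS _ eS; rewrite mulrDl mulfK ?gt_eqF// lerD2r ule.
  by exists e1 => //; have ce := cS _ e1S; rewrite mulrDl mulfK ?gt_eqF// eu.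
have mext u v : {in S, u =1 v} -> m u = m v.
  move=> uv; apply/(fmin_eqP _ _ e0S).
  have [vle [e1 e1S ev]] := (fmin_eqP (fun e => v e / c e) (m v) e0S).1 erefl.
  by split=> [e eS|]; [rewrite uv// vle|exists e1 => //; rewrite uv].
have mpos u : 0 < m u <-> forall e, e \in S -> 0 < u e.
  have [ule [e1 e1S eu]] := (fmin_eqP (fun e => u e / c e) (m u) e0S).1 erefl.
  split=> [mu e eS|u0]; last by rewrite eu divr_gt0 ?u0 ?cS.
  by have := lt_le_trans mu (ule _ eS); rewrite pmulr_lgt0// invr_gt0 cS.
have cl e : e \in G -> c e = \sum_j gam j * b j e by move=> eG; exact: (bspan cW eG).
have g2A s : 0 < s j0 -> A (g2 s).
  move=> s0; apply/open_cellP; rewrite /g2; split=> e.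
  - by move/negbTE ->.
  - move=> eS; rewrite SG//.
    by move: e eS; apply/mpos; rewrite mshift addrC subrK.
  - move=> eG; rewrite eG.
    have lE j : lam (fun e => if e \in G then Y s e + (s j0 - m (Y s)) * c e else 0) j =
        lam (Y s) j + (s j0 - m (Y s)) * gam j.
      by rewrite -lamD; apply: lamext => i ->.
    under eq_bigr do rewrite lE mulrDl -mulrA.
    rewrite big_split /= -mulr_sumr -cl//; congr (_ + _).
    rewrite /Y big_mkcond /=; apply: eq_bigr => j _; rewrite lamY.
    by case: (j == j0); rewrite /= ?mul0r.
have hg2 s : h (g2 s) = (fun j => if j == j0 then s j0 else posroot (s j)).
  apply/funext => j; rewrite /h; have [jj0|jj0] := eqVneq j j0.
    have -> : m (g2 s) = m (fun e => Y s e + (s j0 - m (Y s)) * c e).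
      by apply: mext => e eS; rewrite /g2 SG.
    by rewrite mshift addrC subrK.
  congr posroot; rewrite /l.
  have lE i : lam (g2 s) i = lam (Y s) i + (s j0 - m (Y s)) * gam i.
    by rewrite -lamD; apply: lamext => e eG; rewrite /g2 eG.
  rewrite !lE !lamY eqxx (negbTE jj0); field; exact: gam0.
have g2h x : A x -> g2 (fun j => if j == j0 then m x else l x j) = x.
  move=> /open_cellP[x0 x1 xl]; apply/funext => e; rewrite /g2 eqxx.
  case: ifPn => eG; last by rewrite x0.
  set s := fun j => _.
  have YE i : i \in G -> Y s i = x i - lam x j0 / gam j0 * c i.
    move=> iG; rewrite xl// cl// mulr_sumr -sumrB (bigD1 j0)//=.
    rewrite [X in _ = X + _](_ : _ = 0) ?add0r; last by field; exact: gam0.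
    apply: eq_bigr => j jj0; rewrite /s (negbTE jj0) /l; field; exact: gam0.
  have -> : m (Y s) = m x - lam x j0 / gam j0.
    rewrite -mshift; apply: mext => i /SG iG; rewrite YE//; ring.
  by rewrite YE//; ring.
have sigK x : A x -> sig (h x) = (fun j => if j == j0 then m x else l x j).
  move=> Ax; apply/funext => j; rewrite /sig /h; case: eqP => // _.
  have := posroot_gt0 (l x j); set s := posroot _ => s0.
  have := (posrootP (l x j) s0).1 erefl => h1.
  have -> : l x j = (s ^+ 2 - 1) / s by rewrite h1 mulfK// gt_eqF.
  by field; rewrite gt_eqF.
exists h; split.
  exists (fun s => g2 (sig s)); split.
  - move=> x /open_cellP[x0 x1 xl] j; rewrite /h; case: ifP => _; last exact: posroot_gt0.
    exact/mpos.
  - by move=> s s0; apply: g2A; rewrite /sig eqxx; exact: s0.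
  - by move=> x Ax; rewrite sigK// g2h.
  - move=> s s0; rewrite hg2; apply/funext => j; rewrite /sig eqxx.
    have [->//|jj0] := eqVneq j j0; apply/posrootP; first exact: s0.
    by have := s0 j => sj; field; rewrite gt_eqF.
  - split.
      apply: continuous_subspaceT; apply: continuous_ptws => j; rewrite /h.
      have clam i : continuous (fun x : {ptws E -> R} => lam x i).
        apply: (@continuous_sumr R {ptws E -> R} _ _ _ (fun e x => beta i e * x e)) => e _.
        apply: (@continuousMr R {ptws E -> R}); first exact: continuous_cstr.
        exact: continuous_coord.
      have [_|jj0] := eqVneq j j0.
        apply: fmin_continuous => e; apply: (@continuousMr R {ptws E -> R} (fun x => x e)).
          exact: continuous_coord.
        exact: continuous_cstr.
      move=> x; apply: (@continuous_comp _ _ _ (fun x : {ptws E -> R} => l x j) (@posroot R)).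
        apply: (@continuousBr R {ptws E -> R}); first exact: clam.
        by apply: (@continuousMr R {ptws E -> R}); [exact: clam|exact: continuous_cstr].
      exact: posroot_continuous.
    apply: continuous_in_subspaceT => s /set_mem s0.
    have csig : {for s, continuous sig}.
      apply: (@cvg_ptws _ _ _ (nbhs s) (nbhs_filter s) sig (sig s)) => j; rewrite /sig.
      have cj : (fun t : {ptws 'I_k -> R} => t j) @ s --> s j by exact: continuous_coord.
      have [_|jj0] := eqVneq j j0; first exact: cj.
      by apply: cvgB => //; apply: cvgV => //; rewrite gt_eqF// s0.
    apply: (continuous_comp csig).
    suff : continuous g2 by exact.
    have cY e : continuous (fun s : {ptws 'I_k -> R} => Y s e).
      apply: (@continuous_sumr R {ptws 'I_k -> R} _ _ _ (fun j s => s j * b j e)) => j _.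
      apply: (@continuousMr R {ptws 'I_k -> R} (fun s => s j)); first exact: continuous_coord.
      exact: continuous_cstr.
    apply: continuous_ptws => e; rewrite /g2.
    case: (e \in G); last exact: continuous_cstr.
    apply: (@continuousDr R {ptws 'I_k -> R}); first exact: cY.
    apply: (@continuousMr R {ptws 'I_k -> R}); last exact: continuous_cstr.
    apply: (@continuousBr R {ptws 'I_k -> R} (fun s => s j0)); first exact: continuous_coord.
    apply: (@fmin_continuous R E {ptws 'I_k -> R}) => i.
    by apply: (@continuousMr R {ptws 'I_k -> R}); [exact: cY|exact: continuous_cstr].
(* The minimum and the root are not polynomial, so the graph is described by their
   characterisations; the false equation 1 = 0 encodes membership of e in [S]. *)
pose cond j := if j == j0
  then [set z : (E + 'I_k)%type -> R | forall e, e \in S -> z (inr j) * c e <= z (inl e)] `&`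
       [set z : (E + 'I_k)%type -> R | exists e,
          ((e \in S -> z (inr j) * c e = z (inl e)) /\ (e \notin S -> (1 : R) = 0))]
  else [set z : (E + 'I_k)%type -> R | 0 < z (inr j)] `&`
       [set z : (E + 'I_k)%type -> R |
          z (inr j) ^+ 2 - 1 = l (fun e => z (inl e)) j * z (inr j)].
have -> : graph_on A h = [set z | A (fun i => z (inl i))] `&` [set z | forall j, cond j z].
  apply/seteqP; split=> z [Az hz]; split=> //; last first.
    apply/funext => j; have := hz j; rewrite /cond /h; case: eqP => _ [h1 h2].
      apply/(fmin_eqP _ _ e0S); split=> [e eS|].
        by rewrite ler_pdivlMr ?cS// h1.
      have [e [eS1 eS2]] := h2; have [eS|/eS2/eqP] := boolP (e \in S); last by rewrite oner_eq0.
      by exists e => //; rewrite -(eS1 eS) mulfK// gt_eqF// cS.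
    exact/posrootP.
  move=> j; have := congr1 (fun f => f j) hz; rewrite /h /cond /=.
  case: eqP => _ hj.
    have [h1 [e eS h2]] := (fmin_eqP _ _ e0S).1 hj; split.
      by move=> i iS /=; rewrite -ler_pdivlMr ?cS// h1.
    by exists e; split=> [_|]; [rewrite h2 divfK// gt_eqF// cS|rewrite eS].
  have zj : 0 < z (inr j) by rewrite -hj posroot_gt0.
  by split=> //=; apply/posrootP.
apply: semialgI; first exact: semialg_pullback open_cell_semialg.
apply: semialg_forall => j; rewrite /cond; case: ifP => _; apply: semialgI.
- apply: semialg_forall => e; apply: semialg_imply; apply: semialg_le; last exact: polyfun_var.
  by apply: polyfunM; [exact: polyfun_var|exact: polyfun_cst].
- apply: semialg_exists => e; apply: semialgI; apply: semialg_imply; apply: semialg_eq;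
    try exact: polyfun_var; try exact: polyfun_cst.
  by apply: polyfunM; [exact: polyfun_var|exact: polyfun_cst].
- by apply: semialg_gt0; exact: polyfun_var.
- apply: semialg_eq; first by apply: polyfunB; [apply: polyfunX; exact: polyfun_var|exact: polyfun_cst].
  apply: polyfunM; last exact: polyfun_var.
  have plam i : polyfun (fun z : (E + 'I_k)%type -> R => lam (fun e => z (inl e)) i).
    apply: polyfun_sum => e; apply: polyfunM; [exact: polyfun_cst|exact: polyfun_var].
  by apply: polyfunB => //; apply: polyfunM => //; exact: polyfun_cst.
Qed.

End OpenCell.

(** * Gauges of convex bodies *)

Section Gauge.
Variables (R : realType) (d : nat) (O : set ('I_d -> R)).
Hypothesis convO : forall (x y : 'I_d -> R) (t : R), O x -> O y -> 0 <= t -> t <= 1 ->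
  O (fun i => (1 - t) * x i + t * y i).
Hypothesis O0 : O (fun=> 0).
Hypothesis openO : forall x, O x -> exists2 r : R, 0 < r &
  forall y : 'I_d -> R, (forall i, `|y i| <= r) -> O (fun i => x i + y i).
Hypothesis bndO : exists2 M : R, 0 < M & forall x, O x -> forall i, `|x i| <= M.

Let X := {ptws 'I_d -> R}.

Definition gauge (x : 'I_d -> R) : R := inf [set t | 0 < t /\ O (fun i => t^-1 * x i)].

Let sum_norm_ge (x : 'I_d -> R) i : `|x i| <= \sum_i `|x i|.
Proof. by rewrite (bigD1 i)//= lerDl sumr_ge0. Qed.

Lemma gauge_linear_bound : exists2 r : R, 0 < r & forall x (s : R), 0 < s ->
  \sum_i `|x i| <= r * s -> O (fun i => s^-1 * x i).
Proof.
have [r r0 hr] := openO O0; exists r => // x s s0 xs.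
have := hr (fun i => s^-1 * x i).
rewrite (_ : (fun i => _ + _) = (fun i => s^-1 * x i)); last first.
  by apply/funext => i; rewrite add0r.
apply=> i; rewrite normrM gtr0_norm ?invr_gt0// mulrC ler_pdivrMr//.
exact: le_trans (sum_norm_ge x i) xs.
Qed.

Let gauge_set_nonempty x : [set t | 0 < t /\ O (fun i => t^-1 * x i)] !=set0.
Proof.
have [r r0 hr] := gauge_linear_bound.
exists ((\sum_i `|x i|) / r + 1).
have s0 : 0 <= (\sum_i `|x i|) / r by rewrite divr_ge0 ?sumr_ge0// ltW.
split; first by rewrite ltr_wpDl.
apply: hr; first by rewrite ltr_wpDl.
by rewrite mulrDr mulr1 mulrC divfK ?gt_eqF// lerDl ltW.
Qed.

Lemma gauge_ge0 x : 0 <= gauge x.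
Proof. by apply: lb_le_inf; [exact: gauge_set_nonempty|move=> t [/ltW]]. Qed.

(** Convexity and the origin make [O] star-shaped, which gives one direction. For the other,
    openness lets the scale drop slightly below [s]. *)
Lemma gauge_ltP x (s : R) : 0 < s -> gauge x < s <-> O (fun i => s^-1 * x i).
Proof.
move=> s0; split=> [/(inf_lt (gauge_set_nonempty x))[t [t0 Ot] ts]|Os].
  have := @convO _ _ (t / s) O0 Ot; have -> :
    (fun i => (1 - t / s) * 0 + t / s * (t^-1 * x i)) = (fun i => s^-1 * x i).
    by apply/funext => i; rewrite mulr0 add0r; field; rewrite !gt_eqF.
  by apply; [rewrite divr_ge0 ?ltW|rewrite ler_pdivrMr// mul1r ltW].
have [r r0 hr] := openO Os.
(* Small enough that enlarging the point by the factor 1 + eps moves every coordinate by at most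
   [r]; this replaces s by s / (1 + eps). *)
pose eps := r / (1 + \sum_i `|s^-1 * x i|).
have n0 : 0 <= \sum_i `|s^-1 * x i| by apply: sumr_ge0.
have eps0 : 0 < eps by rewrite divr_gt0// ltr_pwDl.
have : O (fun i => (s / (1 + eps))^-1 * x i).
  have := hr (fun i => eps * (s^-1 * x i)).
  have -> : (fun i => s^-1 * x i + eps * (s^-1 * x i)) =
            (fun i => (s / (1 + eps))^-1 * x i).
    by apply/funext => i; field; rewrite !gt_eqF// ltr_pwDl// ltW.
  apply=> i; rewrite normrM gtr0_norm// /eps mulrAC ler_pdivrMr ?ltr_pwDl//.
  rewrite ler_pM2l//; apply: le_trans (sum_norm_ge (fun i => s^-1 * x i) i) _.
  by rewrite lerDr.
have e1 : 0 < 1 + eps by rewrite ltr_pwDl// ltW.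
move=> Oe; apply: (@le_lt_trans _ _ (s / (1 + eps))).
  by apply: inf_lbound; [exists 0 => t [/ltW]|split=> //; rewrite divr_gt0].
by rewrite ltr_pdivrMr// ltr_pMr// ltrDl.
Qed.

Lemma gauge_lt1 x : gauge x < 1 <-> O x.
Proof.
have := gauge_ltP x ltr01; rewrite invr1.
by under [X in _ <-> O X]funext do rewrite mul1r.
Qed.

Lemma gaugeZ (a : R) x : 0 < a -> gauge (fun i => a * x i) = a * gauge x.
Proof.
move=> a0.
have key s : 0 < s -> gauge (fun i => a * x i) < s <-> a * gauge x < s.
  move=> s0; rewrite [a * _]mulrC -ltr_pdivlMr//.
  apply: iff_trans (gauge_ltP _ s0) _; apply: iff_sym.
  have sa0 : 0 < s / a by rewrite divr_gt0.
  apply: iff_trans (gauge_ltP x sa0) _.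
  suff -> : (fun i => (s / a)^-1 * x i) = (fun i => s^-1 * (a * x i)) by [].
  by apply/funext => i; field; rewrite !gt_eqF.
apply/eqP; rewrite eq_le !leNgt; apply/andP; split; apply/negP => h.
  have s0 : 0 < gauge (fun i => a * x i).
    by apply: le_lt_trans h; rewrite mulr_ge0 ?gauge_ge0// ltW.
  by have := (key _ s0).2 h; rewrite ltxx.
have s0 : 0 < a * gauge x by apply: le_lt_trans h; exact: gauge_ge0.
by have := (key _ s0).1 h; rewrite ltxx.
Qed.

Lemma gaugeD x y : gauge (fun i => x i + y i) <= gauge x + gauge y.
Proof.
apply/ler_addgt0Pr => e e0; apply: ltW.
have e2 : 0 < e / 2 by rewrite divr_gt0.
have [gx gy] := (gauge_ge0 x, gauge_ge0 y).
have x0 : 0 < gauge x + e / 2 by rewrite ltr_wpDl.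
have y0 : 0 < gauge y + e / 2 by rewrite ltr_wpDl.
have Ox : O (fun i => (gauge x + e / 2)^-1 * x i) by apply/gauge_ltP => //; rewrite ltrDl.
have Oy : O (fun i => (gauge y + e / 2)^-1 * y i) by apply/gauge_ltP => //; rewrite ltrDl.
have -> : gauge x + gauge y + e = (gauge x + e / 2) + (gauge y + e / 2) by field.
move: x0 y0 Ox Oy; set s := gauge x + _; set t := gauge y + _ => s0 t0 Os Ot.
have st0 : 0 < s + t by rewrite addr_gt0.
apply/gauge_ltP => //; have := @convO _ _ (t / (s + t)) Os Ot.
have -> : (fun i => (1 - t / (s + t)) * (s^-1 * x i) + t / (s + t) * (t^-1 * y i)) =
          (fun i => (s + t)^-1 * (x i + y i)).
  by apply/funext => i; field; rewrite !gt_eqF.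
by apply; [rewrite divr_ge0 ?ltW|rewrite ler_pdivrMr// mul1r lerDr ltW].
Qed.

Lemma gauge0 : gauge (fun=> 0) = 0.
Proof.
apply/eqP; rewrite eq_le gauge_ge0 andbT; apply/ler_addgt0Pr => e e0; rewrite add0r ltW//.
by apply/gauge_ltP => //; under [X in O X]funext do rewrite mulr0.
Qed.

Lemma gauge_gt0 x i : x i != 0 -> 0 < gauge x.
Proof.
move=> xi; have [M M0 hM] := bndO.
have : 0 < `|x i| / M by rewrite divr_gt0 ?normr_gt0.
move=> /lt_le_trans; apply; apply: lb_le_inf; first exact: gauge_set_nonempty.
move=> t [t0 /hM/(_ i)]; rewrite normrM gtr0_norm ?invr_gt0// => h.
rewrite ler_pdivrMr//; move: h; rewrite mulrC ler_pdivrMr//.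
by rewrite mulrC.
Qed.

Lemma gauge_le : exists2 C : R, 0 < C & forall x, gauge x <= C * \sum_i `|x i|.
Proof.
have [r r0 hr] := gauge_linear_bound; exists r^-1; first by rewrite invr_gt0.
move=> x; apply/ler_addgt0Pr => e e0.
have s0 : 0 <= \sum_i `|x i| by apply: sumr_ge0.
apply: ltW; apply/gauge_ltP; first by rewrite ltr_wpDl// mulr_ge0// invr_ge0 ltW.
apply: hr; first by rewrite ltr_wpDl// mulr_ge0// invr_ge0 ltW.
rewrite mulrDr mulrA mulfV ?gt_eqF// mul1r lerDl mulr_ge0// ltW//.
Qed.

(** Subadditivity and the linear bound make the gauge Lipschitz for the l1 distance. *)
Lemma gauge_continuous : continuous (gauge : X -> R).
Proof.
have [C C0 hC] := gauge_le => x.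
have cN : (fun y : X => C * \sum_i `|y i - x i|) @ x --> C * \sum_i `|x i - x i|.
  apply: (@continuousMr R X (fun=> C)); first exact: continuous_cstr.
  apply: (@continuous_sumr R X _ _ xpredT (fun i y => `|y i - x i|)) => i _ y.
  apply: (@continuous_comp X R R (fun y : X => y i - x i) Num.norm).
    apply: (@continuousBr R X (fun y => y i)); [exact: continuous_coord|exact: continuous_cstr].
  exact: norm_continuous.
have N0 : C * \sum_i `|x i - x i| = 0.
  by rewrite big1 ?mulr0// => i _; rewrite subrr normr0.
rewrite N0 in cN.
apply/(@cvgrPdist_lt _ R^o _ _ (nbhs_filter x)) => e e0.
have := (@cvgrPdist_lt _ R^o _ _ (nbhs_filter x) _ _).1 cN e e0.
apply: (@filterS _ _ (nbhs_filter x)) => y; rewrite sub0r normrN => h.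
have {}h := le_lt_trans (ler_norm _) h.
have h1 : gauge x <= gauge y + C * \sum_i `|y i - x i|.
  have := gaugeD y (fun i => x i - y i); under [X in gauge X]funext do rewrite addrC subrK.
  move=> /le_trans; apply; rewrite lerD2l; apply: le_trans (hC _) _.
  by rewrite ler_pM2l// (eq_bigr (fun i => `|y i - x i|))// => i _; rewrite distrC.
have h2 : gauge y <= gauge x + C * \sum_i `|y i - x i|.
  have := gaugeD x (fun i => y i - x i); under [X in gauge X]funext do rewrite addrC subrK.
  by move=> /le_trans; apply; rewrite lerD2l; exact: hC.
by rewrite ltr_norml; lra.
Qed.

(** * Radial comparison with the Euclidean norm *)

Definition enorm (x : 'I_d -> R) : R := Num.sqrt (\sum_i x i ^+ 2).

Lemma enorm_ge (x : 'I_d -> R) i : `|x i| <= enorm x.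
Proof.
rewrite -sqrtr_sqr ler_sqrt; last by apply: sumr_ge0 => j _; exact: sqr_ge0.
by rewrite (bigD1 i)//= lerDl sumr_ge0// => j _; exact: sqr_ge0.
Qed.

Lemma enorm_ge0 x : 0 <= enorm x.
Proof. exact: sqrtr_ge0. Qed.

Lemma enorm_gt0 (x : 'I_d -> R) i : x i != 0 -> 0 < enorm x.
Proof. by move=> xi; apply: lt_le_trans (enorm_ge x i); rewrite normr_gt0. Qed.

Lemma enormZ a (x : 'I_d -> R) : 0 <= a -> enorm (fun i => a * x i) = a * enorm x.
Proof.
move=> a0; rewrite /enorm; under eq_bigr do rewrite exprMn.
by rewrite -mulr_sumr sqrtrM ?sqr_ge0// sqrtr_sqr ger0_norm.
Qed.

Lemma sqr_enorm x : \sum_i x i ^+ 2 = enorm x ^+ 2.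
Proof. by rewrite sqr_sqrtr// sumr_ge0// => i _; exact: sqr_ge0. Qed.

Lemma enorm_continuous : continuous (enorm : X -> R).
Proof.
move=> x; apply: (@continuous_comp X R R (fun x : X => \sum_i x i ^+ 2) Num.sqrt).
  apply: (@continuous_sumr R X _ _ xpredT (fun i y => y i ^+ 2)) => i _.
  by apply: (@continuousXr R X (fun y => y i)); exact: continuous_coord.
exact: sqrt_continuous.
Qed.

Let zero_or_coord (x : 'I_d -> R) : x = (fun=> 0) \/ exists i, x i != 0.
Proof.
have [[i xi]|h] := pselect (exists i, x i != 0); [by right; exists i|left].
by apply/funext => i; apply/eqP; apply: contrapT => /negP xi; apply: h; exists i.
Qed.

Lemma enorm0 : enorm (fun=> 0) = 0.
Proof. by rewrite /enorm big1 ?sqrtr0// => i _; rewrite expr0n. Qed.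

(* Radial rescaling of the gauge to the Euclidean norm; at the origin 0 / 0 = 0. *)
Definition to_ball (x : X) : X := fun i => gauge x / enorm x * x i.

Lemma enorm_to_ball x : enorm (to_ball x) = gauge x.
Proof.
rewrite /to_ball enormZ ?divr_ge0 ?gauge_ge0 ?enorm_ge0//.
have [->|[i xi]] := zero_or_coord x; first by rewrite gauge0 enorm0 mulr0.
by rewrite divfK// gt_eqF// (enorm_gt0 xi).
Qed.

(** The norm of the image recovers the gauge and the direction is unchanged, so x = s y with s > 0,
    and homogeneity of the gauge gives s = 1. *)
Lemma to_ball_inj x y : to_ball x = to_ball y -> x = y.
Proof.
move=> xy; have gxy : gauge x = gauge y by rewrite -!enorm_to_ball xy.
have [x0|[i xi]] := zero_or_coord x.
  have [->//|[i yi]] := zero_or_coord y.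
  by have := gauge_gt0 yi; rewrite -gxy x0 gauge0 ltxx.
have [y0|[j yj]] := zero_or_coord y.
  by have := gauge_gt0 xi; rewrite gxy y0 gauge0 ltxx.
have [nx ny gx] := And3 (enorm_gt0 xi) (enorm_gt0 yj) (gauge_gt0 xi).
pose s := enorm x / enorm y.
have s0 : 0 < s by rewrite divr_gt0.
have xE : x = (fun i => s * y i).
  apply/funext => l; have := congr1 (fun f => f l) xy; rewrite /to_ball -gxy => h.
  have -> : x l = (gauge x / enorm x * x l) * (enorm x / gauge x).
    by field; rewrite !gt_eqF.
  by rewrite h /s; field; rewrite !gt_eqF.
have : s = 1.
  have := gaugeZ y s0; rewrite -xE -gxy => h.
  by apply: (mulIf (lt0r_neq0 gx)); rewrite -h mul1r.
by move=> s1; rewrite xE s1; apply/funext => l; rewrite mul1r.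
Qed.

Lemma to_ball_surj y : exists x, to_ball x = y.
Proof.
have [y0|[i yi]] := zero_or_coord y.
  by exists y; rewrite y0; apply/funext => i; rewrite /to_ball mulr0.
have [ny gy] := (enorm_gt0 yi, gauge_gt0 yi).
have s0 : 0 < enorm y / gauge y by rewrite divr_gt0.
exists (fun i => enorm y / gauge y * y i); apply/funext => l.
by rewrite /to_ball gaugeZ// enormZ ?ltW//; field; rewrite !gt_eqF.
Qed.

Lemma to_ball_lt1 x : \sum_i to_ball x i ^+ 2 < 1 <-> O x.
Proof.
rewrite sqr_enorm enorm_to_ball expr_lt1 ?gauge_ge0//; exact: gauge_lt1.
Qed.

(** A product of continuous functions away from the origin. At the origin the direction has no
    limit, but each coordinate is bounded by the gauge. *)
Lemma to_ball_continuous : continuous to_ball.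
Proof.
apply: continuous_ptws => i x.
have cxi : (fun y : X => y i) @ x --> x i by exact: continuous_coord.
have [x0|[j xj]] := zero_or_coord x; last first.
  have cg : gauge y @[y --> x] --> gauge x := @gauge_continuous x.
  have cn : enorm y @[y --> x] --> enorm x := @enorm_continuous x.
  have nx : enorm x != 0 by rewrite gt_eqF// (enorm_gt0 xj).
  exact: (cvgM (cvgM cg (cvgV nx cn)) cxi).
have tx : to_ball x i = 0 by rewrite /to_ball x0 mulr0.
suff : (fun y : X => to_ball y i) @ x --> (0 : R) by rewrite -tx.
apply/(@cvgrPdist_lt _ R^o _ _ (nbhs_filter x)) => e e0.
have := (@cvgrPdist_lt _ R^o _ _ (nbhs_filter x) _ _).1 (@gauge_continuous x) e e0.
apply: (@filterS _ _ (nbhs_filter x)) => y h.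
have gx : gauge x = 0 by rewrite x0 gauge0.
have {}h : `|gauge x - gauge y| < e := h.
suff : `|0 - to_ball y i| < e by [].
move: h; rewrite gx !sub0r (normrN (gauge y)) (normrN (to_ball y i)); apply: le_lt_trans.
by rewrite (ger0_norm (gauge_ge0 y)) -enorm_to_ball; exact: enorm_ge.
Qed.

End Gauge.

(** * Exponential families *)

Section ExponentialFamily.
Variable R : realType.

(** Inverts exp(- y) >= 1 - y. With this bound a minimiser can be tested by a finite step instead of
    a derivative. *)
Lemma expR_le_quadratic (y : R) : y <= 1 / 2 -> expR y <= 1 + y + 2 * y ^+ 2.
Proof.
move=> y2; rewrite -[y in expR y]opprK expRN.
have h := expR_ge1Dx (- y); have y1 : 0 < 1 - y by lra.
apply: (@le_trans _ _ (1 - y)^-1); first by rewrite lef_pV2 ?posrE ?expR_gt0.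
rewrite -[leLHS]mul1r ler_pdivrMr//.
have -> : (1 + y + 2 * y ^+ 2) * (1 - y) = 1 + y ^+ 2 * (1 - 2 * y) by ring.
by rewrite lerDl mulr_ge0 ?sqr_ge0//; lra.
Qed.

(** The square of the tangent bound at t / 2; the superlinear growth is used for coercivity. *)
Lemma expR_ge_quadratic (t : R) : 0 <= t -> t ^+ 2 / 4 <= expR t.
Proof.
move=> t0; have -> : t = t / 2 + t / 2 by field.
rewrite [in leRHS]expRD; have h := expR_ge1Dx (t / 2).
apply: (@le_trans _ _ ((1 + t / 2) * (1 + t / 2))).
  have -> : (1 + t / 2) * (1 + t / 2) = (t / 2 + t / 2) ^+ 2 / 4 + (1 + t) by field.
  by rewrite lerDl; lra.
by apply: ler_pM => //; lra.
Qed.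

Definition dot d (x y : 'I_d -> R) : R := \sum_j x j * y j.

Lemma dotDr d (x y z : 'I_d -> R) (t : R) :
  dot x (fun j => y j + t * z j) = dot x y + t * dot x z.
Proof. by rewrite /dot mulr_sumr -big_split; apply: eq_bigr => j _ /=; ring. Qed.

Lemma dot0 d (x : 'I_d -> R) : dot x (fun=> 0) = 0.
Proof. by rewrite /dot big1// => j _; rewrite mulr0. Qed.

Lemma dot_unit d (x : 'I_d -> R) j : dot x (fun i => (i == j)%:R) = x j.
Proof.
rewrite /dot (bigD1 j)//= eqxx mulr1 big1 ?addr0// => i ij.
by rewrite (negbTE ij) mulr0.
Qed.

Lemma dot_continuous d (x : 'I_d -> R) : continuous (fun y : {ptws 'I_d -> R} => dot x y).
Proof.
apply: (@continuous_sumr R {ptws 'I_d -> R} _ _ xpredT (fun j y => x j * y j)) => j _.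
by apply: (@continuousMr R {ptws 'I_d -> R}); [exact: continuous_cstr|exact: continuous_coord].
Qed.

Lemma compact_cube d (T : R) : compact [set x : {ptws 'I_d -> R} | forall j, `|x j| <= T].
Proof.
have := @tychonoff 'I_d (fun=> R) (fun=> `[- T, T]%classic)
  (fun=> @segment_compact R (- T) T).
congr compact; apply/seteqP; split=> x /= h j; have := h j.
  by rewrite /= in_itv /= -ler_norml.
by rewrite /= in_itv /= -ler_norml.
Qed.

Variables (d : nat) (E : finType) (S : {set E}) (e0 : E) (a : E -> 'I_d -> R)
  (gam : 'I_d -> R) (beta : 'I_d -> E -> R) (xi : 'I_d -> R) (delta : R).
Hypotheses (e0S : e0 \in S)
  (agam : forall e, e \in S -> dot (a e) gam = 1)
  (abeta : forall kap j, kap j = \sum_(e in S) beta j e * dot (a e) kap)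
  (delta0 : 0 < delta)
  (xiP : forall kap, (forall e, e \in S -> 0 <= dot (a e) kap) ->
     delta * \sum_(e in S) dot (a e) kap <= dot xi kap).

(** In the hypotheses, [agam] normalises the functionals along the direction [gam], [abeta] recovers
    coordinates from their values, and [xiP] places [xi] uniformly inside the dual cone. *)
Let f (lam : 'I_d -> R) : R := \sum_(e in S) expR (- dot (a e) lam) + dot xi lam.

Let f_continuous : continuous (f : {ptws 'I_d -> R} -> R).
Proof.
apply: (@continuousDr R {ptws 'I_d -> R}); last exact: dot_continuous.
apply: (@continuous_sumr R {ptws 'I_d -> R} _ _ (mem S)
  (fun e lam => expR (- dot (a e) lam))) => e _ x.
apply: (@continuous_comp {ptws 'I_d -> R} R R (fun x => - dot (a e) x) expR).
  by apply: (@continuousNr R {ptws 'I_d -> R}); exact: dot_continuous.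
exact: continuous_expR.
Qed.

Lemma coord_bound (kap : 'I_d -> R) j : (forall e, e \in S -> 0 <= dot (a e) kap) ->
  `|kap j| <= (\sum_i \sum_(e in S) `|beta i e|) * \sum_(e in S) dot (a e) kap.
Proof.
move=> kap0; rewrite abeta.
apply: le_trans (ler_norm_sum _ _ _) _.
have le1 e : e \in S -> `|beta j e| <= \sum_i \sum_(e in S) `|beta i e|.
  move=> eS; apply: (@le_trans _ _ (\sum_(e in S) `|beta j e|)).
    by rewrite (bigD1 e)//= lerDl sumr_ge0.
  by rewrite (bigD1 j)//= lerDl; do 2 (apply: sumr_ge0 => ? _).
rewrite mulr_sumr; apply: ler_sum => e eS.
by rewrite normrM [`|dot _ _|]ger0_norm ?kap0// ler_wpM2r ?kap0// le1.
Qed.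

(** Coercivity. Write lam = kap + n gam with n the least value of a functional, so that kap lies in
    the cone. Then f lam >= exp(- n) + delta sg + n s, where sg sums the functionals at kap: the
    linear term controls n > 0, the exponential n < 0, and the delta term kap. *)
Let sublevel_bounded : exists2 T : R, 0 <= T &
  forall lam, f lam <= f (fun=> 0) -> forall j, `|lam j| <= T.
Proof.
pose s := dot xi gam; pose N := f (fun=> 0).
have N1 : 1 <= N.
  rewrite /N /f dot0 addr0 (bigD1 e0)//= dot0 oppr0 expR0.
  by rewrite lerDl sumr_ge0// => e _; exact: expR_ge0.
have s0 : 0 < s.
  apply: lt_le_trans (xiP _); last by move=> e eS; rewrite agam.
  rewrite mulr_gt0// (bigD1 e0)//= agam// ltr_wpDr// sumr_ge0// => e /andP[eS _].
  by rewrite agam.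
(* N / s caps positive n. If - n exceeds 4 (s + N) + 1, then n^2 / 4 + n s > N, which caps negative
   n. [T2] is the resulting bound on the delta term divided by delta. *)
pose T1 := 4 * (s + N) + 1 + N / s.
have Ns : 0 <= N / s by rewrite divr_ge0 ?ltW//; lra.
have T10 : 0 <= T1 by rewrite /T1; lra.
pose T2 := (N + T1 * s) / delta.
have T20 : 0 <= T2 by rewrite divr_ge0 ?ltW// addr_gt0//; [lra|rewrite mulr_gt0// /T1; lra].
pose B := \sum_i \sum_(e in S) `|beta i e|.
have B0 : 0 <= B by do 2 (apply: sumr_ge0 => ? _).
pose Gm := \sum_j `|gam j|.
have G0 : 0 <= Gm by apply: sumr_ge0.
exists (B * T2 + T1 * Gm); first by apply: addr_ge0; apply: mulr_ge0.
move=> lam fle j.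
pose n := fmin S e0 (fun e => dot (a e) lam).
have [nle [e1 e1S ne1]] := (fmin_eqP (fun e => dot (a e) lam) n e0S).1 erefl.
pose kap j := lam j + (- n) * gam j.
have akap e : e \in S -> dot (a e) kap = dot (a e) lam - n.
  by move=> eS; rewrite /kap dotDr agam// mulr1.
have kap0 e : e \in S -> 0 <= dot (a e) kap by move=> eS; rewrite akap// subr_ge0 nle.
have hxi := xiP kap0.
set sg := \sum_(e in S) dot (a e) kap in hxi.
have sg0 : 0 <= sg by apply: sumr_ge0 => e; exact: kap0.
have xikap : dot xi kap = dot xi lam - n * s by rewrite /kap dotDr mulNr.
have exps : expR (- n) <= \sum_(e in S) expR (- dot (a e) lam).
  by rewrite (bigD1 e1)//= -ne1 lerDl sumr_ge0// => e _; exact: expR_ge0.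
have dsg : 0 <= delta * sg by rewrite mulr_ge0// ltW.
have fle' : \sum_(e in S) expR (- dot (a e) lam) + dot xi lam <= N := fle.
have tot : expR (- n) + delta * sg + n * s <= N by rewrite xikap in hxi; lra.
have nT : `|n| <= T1.
  have [n0|n0] := leP 0 n.
    rewrite ger0_norm//; apply: (@le_trans _ _ (N / s)); last by rewrite /T1; lra.
    by rewrite ler_pdivlMr//; have := expR_gt0 (- n); lra.
  rewrite ltr0_norm// leNgt; apply/negP => nT1.
  have t0 : 0 <= - n by lra.
  have := expR_ge_quadratic t0; have t1 : 1 < - n by apply: le_lt_trans nT1; rewrite /T1; lra.
  have t2 : s + N < (- n) / 4 by move: nT1; rewrite /T1; lra.
  have : N < (- n) * ((- n) / 4 - s).
    rewrite -[ltLHS]mul1r; apply: ltr_pM => //; lra.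
  have -> : (- n) * ((- n) / 4 - s) = (- n) ^+ 2 / 4 + n * s by field.
  lra.
have nsT : - (n * s) <= T1 * s.
  by rewrite -mulNr ler_pM2r//; apply: le_trans nT; rewrite -normrN; exact: ler_norm.
have sgT : sg <= T2.
  by rewrite /T2 ler_pdivlMr// mulrC; have := expR_gt0 (- n); lra.
have -> : lam j = kap j + n * gam j by rewrite /kap; ring.
apply: le_trans (ler_normD _ _) _; apply: lerD.
  apply: le_trans (coord_bound j kap0) _; rewrite -/sg -/B.
  by rewrite ler_wpM2l.
rewrite normrM; apply: ler_pM => //.
by rewrite /Gm (bigD1 j)//= lerDl sumr_ge0.
Qed.

(* The critical point equation of the convex function f. *)
Lemma exponential_family_surj :
  exists lam : 'I_d -> R, forall j, \sum_(e in S) expR (- dot (a e) lam) * a e j = xi j.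
Proof.
have [T T0 hT] := sublevel_bounded.
have cube0 : [set x : {ptws 'I_d -> R} | forall j, `|x j| <= T] !=set0.
  by exists (fun=> 0) => j /=; rewrite normr0.
have [lam lamC lamin] := compact_EVT_min cube0 (@compact_cube d T)
  (continuous_subspaceT f_continuous).
have fmin mu : f lam <= f mu.
  have [fmu|fmu] := leP (f mu) (f (fun=> 0)).
    by apply: lamin; apply/mem_set; exact: hT fmu.
  by apply: le_trans (ltW fmu); apply: lamin; apply/mem_set => j /=; rewrite normr0.
exists lam => j0.
suff main kap : \sum_(e in S) expR (- dot (a e) lam) * dot (a e) kap = dot xi kap.
  rewrite -(dot_unit xi) -main; apply: eq_bigr => e _; by rewrite dot_unit.
pose c e := expR (- dot (a e) lam); pose w e := dot (a e) kap.
(* The derivative of [f] at [lam] along [kap]. *)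
pose D := dot xi kap - \sum_(e in S) c e * w e.
pose Q := \sum_(e in S) c e * w e ^+ 2; pose W := \sum_(e in S) `|w e|.
have c0 e : 0 < c e by exact: expR_gt0.
have Q0 : 0 <= Q by apply: sumr_ge0 => e _; rewrite mulr_ge0 ?sqr_ge0// ltW.
have W0 : 0 <= W by apply: sumr_ge0 => e _; exact: normr_ge0.
have DW0 : 0 <= `|D| * W by rewrite mulr_ge0.
(* The step t = - eta D must keep each exponent at most 1 / 2 and make 2 eta Q < 1; the increment of
   [f], at most eta D^2 (2 eta Q - 1), is then negative unless D = 0. *)
pose eta := (2 * Q + 1 + 2 * (`|D| * W))^-1.
have den0 : 0 < 2 * Q + 1 + 2 * (`|D| * W) by lra.
have eta0 : 0 < eta by rewrite invr_gt0.
pose t := - (eta * D).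
have tw e : e \in S -> - (t * w e) <= 1 / 2.
  move=> eS; apply: le_trans (ler_norm _) _.
  rewrite normrN /t mulNr normrN normrM normrM gtr0_norm// -mulrA.
  apply: (@le_trans _ _ (eta * (`|D| * W))).
    by rewrite ler_pM2l// ler_wpM2l// /W (bigD1 e)//= lerDl sumr_ge0.
  by rewrite mulrC ler_pdivrMr//; lra.
have : f lam <= f lam + (t * D + 2 * t ^+ 2 * Q).
  apply: le_trans (fmin (fun j => lam j + t * kap j)) _.
  rewrite /f dotDr.
  have : \sum_(e in S) expR (- dot (a e) (fun j => lam j + t * kap j)) <=
      \sum_(e in S) (c e + (- t) * (c e * w e) + 2 * t ^+ 2 * (c e * w e ^+ 2)).
    apply: ler_sum => e eS; rewrite dotDr opprD expRD -/(c e) -/(w e).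
    apply: le_trans (ler_wpM2l (ltW (c0 e)) (expR_le_quadratic (tw e eS))) _.
    by rewrite le_eqVlt; apply/orP; left; apply/eqP; ring.
  rewrite !big_split /= -!mulr_sumr -/Q.
  by rewrite /D /c; lra.
rewrite lerDl => h.
have h2 : t * D + 2 * t ^+ 2 * Q = eta * D ^+ 2 * (2 * eta * Q - 1) by rewrite /t; ring.
have D0 : D = 0.
  apply: contrapT => /eqP Dn; have D2 : 0 < D ^+ 2 by rewrite lt_neqAle eq_sym sqrf_eq0 Dn sqr_ge0.
  have e1 : 2 * eta * Q < 1.
    by rewrite mulrAC ltr_pdivrMr//; lra.
  have p0 : 0 < eta * D ^+ 2 by rewrite mulr_gt0.
  by move: h; rewrite h2 (pmulr_rge0 _ p0) subr_ge0 leNgt e1.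
by apply/eqP; rewrite eq_sym -subr_eq0; apply/eqP.
Qed.

End ExponentialFamily.

(** * Closed cells are balls *)

Section Monotonicity.
Variable R : realType.

(** The weight is strictly decreasing on [0, oo], infinity included. Here [u] stands for p - q, of
    which only the sign is meaningful when exactly one of the two is infinite. *)
Lemma P1_exp_mono (c u : R) (p q : P1 R) : 0 < c ->
  (forall a, p = Some a -> 0 <= a) -> (forall a, q = Some a -> 0 <= a) ->
  (forall a b, p = Some a -> q = Some b -> u = a - b) ->
  (forall a, p = Some a -> q = None -> u < 0) ->
  (forall b, p = None -> q = Some b -> 0 < u) ->
  0 <= (P1_exp c q - P1_exp c p) * (u / c) /\
  ((P1_exp c q - P1_exp c p) * (u / c) = 0 -> p = q).
Proof.
move=> c0 p0 q0 h1 h2 h3; case: p p0 h1 h2 h3 => [a|] p0 h1 h2 h3;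
  case: q q0 h1 h2 h3 => [b|] q0 h1 h2 h3 /=.
- have [a0 b0] := (p0 _ erefl, q0 _ erefl); rewrite (h1 _ _ erefl erefl) !ger0_norm//.
  have [ab|ab|->] := ltgtP a b; last by rewrite !subrr mul0r.
    have e0 : expR (- (b / c)) < expR (- (a / c)) by rewrite ltr_expR ltrN2 ltr_pM2r ?invr_gt0.
    have : 0 < (expR (- (b / c)) - expR (- (a / c))) * ((a - b) / c).
      by rewrite nmulr_lgt0 ?subr_lt0// pmulr_llt0 ?invr_gt0// subr_lt0.
    by move=> h; split; [exact: ltW|move=> h0; rewrite h0 ltxx in h].
  have e0 : expR (- (a / c)) < expR (- (b / c)) by rewrite ltr_expR ltrN2 ltr_pM2r ?invr_gt0.
  have : 0 < (expR (- (b / c)) - expR (- (a / c))) * ((a - b) / c).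
    by rewrite mulr_gt0 ?subr_gt0// divr_gt0// subr_gt0.
  by move=> h; split; [exact: ltW|move=> h0; rewrite h0 ltxx in h].
- have u0 := h2 _ erefl erefl.
  have : 0 < (0 - expR (- (`|a| / c))) * (u / c).
    by rewrite sub0r nmulr_lgt0 ?pmulr_llt0 ?invr_gt0// oppr_lt0 expR_gt0.
  by move=> h; split; [exact: ltW|move=> h0; rewrite h0 ltxx in h].
- have u0 := h3 _ erefl erefl.
  have : 0 < (expR (- (`|b| / c)) - 0) * (u / c).
    by rewrite subr0 mulr_gt0 ?divr_gt0// expR_gt0.
  by move=> h; split; [exact: ltW|move=> h0; rewrite h0 ltxx in h].
- by rewrite subrr mul0r.
Qed.

End Monotonicity.

Section ClosedCellBall.
Variables (R : realType) (E : finType) (V : set (E -> R)) (F G : {set E}).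
Hypotheses (hV : is_subspace V) (FG : F \subset G) (aG : is_acyclic_flat V G).

Variables (k : nat) (b beta : 'I_k -> E -> R).
Hypotheses (bV : forall j, vanish_on V F (b j))
  (bbeta : forall i j, \sum_(e in G) beta i e * b j e = (i == j)%:R)
  (bspan : forall w, vanish_on V F w -> forall e, e \in G ->
         w e = \sum_j (\sum_(i in G) beta j i * w i) * b j e).

Variables (c : E -> R) (e0 : E).
Hypotheses (cV : V c) (cF : forall e, e \in F -> c e = 0)
  (cpos : forall e, e \notin F -> 0 < c e) (e0S : e0 \in G :\: F).

Let S := G :\: F.
Let a e (j : 'I_k) := b j e / c e.
Let gam (j : 'I_k) := \sum_(i in G) beta j i * c i.
Let beta' (j : 'I_k) e := beta j e * c e.
Let psi (p : PE R E) e := P1_exp (c e) (p e).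
Let mu p (j : 'I_k) := \sum_(e in S) psi p e * a e j.
Let Sm p := \sum_(e in S) psi p e.
Let tau p := - fmin S e0 (fun e => - psi p e).
(** [Sm p] is the value of mu at [c], and [tau p] the largest weight. If all weights vanish, the
    convention for division by zero gives the value 0, the apex of the dual cone. *)
Let Psi (p : PE R E) : {ptws 'I_k -> R} := fun j => tau p / Sm p * mu p j.

Let inS e : e \in S = (e \notin F) && (e \in G).
Proof. by rewrite inE. Qed.

Let cS e : e \in S -> 0 < c e.
Proof. by rewrite inS => /andP[eF _]; exact: cpos. Qed.

Let SG e : e \in S -> e \in G.
Proof. by rewrite inS => /andP[]. Qed.

Let tauP p s : tau p = s <->
  (forall e, e \in S -> psi p e <= s) /\ (exists2 e, e \in S & s = psi p e).
Proof.
have h := fmin_eqP (fun e => - psi p e) (- s) e0S; split=> [ts|[h1 [e eS h2]]].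
  have [|h1 [e eS h2]] := h.1; first by rewrite -ts opprK.
  split; first by move=> i iS; rewrite -lerN2 h1.
  by exists e => //; apply: oppr_inj.
rewrite /tau (h.2 _) ?opprK//; split; first by move=> i iS; rewrite lerN2 h1.
by exists e => //; rewrite h2.
Qed.

Let psi_ge0 p e : 0 <= psi p e. Proof. exact: P1_exp_ge0. Qed.

Let dot_a (kap : 'I_k -> R) e : e \in S -> dot (a e) kap = (\sum_j kap j * b j e) / c e.
Proof. by move=> eS; rewrite /dot mulr_suml; apply: eq_bigr => j _; rewrite /a; ring. Qed.

Let agam e : e \in S -> dot (a e) gam = 1.
Proof.
move=> eS; rewrite dot_a//; have cW : vanish_on V F c by [].
by rewrite -(bspan cW (SG eS)) mulfV// gt_eqF// cS.
Qed.

Let abeta (kap : 'I_k -> R) j : kap j = \sum_(e in S) beta' j e * dot (a e) kap.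
Proof.
transitivity (\sum_(e in G) beta j e * \sum_i kap i * b i e).
  under eq_bigr do rewrite mulr_sumr.
  rewrite exchange_big /= (bigD1 j)//= [X in _ + X]big1 ?addr0.
    under eq_bigr do rewrite mulrCA.
    by rewrite -mulr_sumr bbeta eqxx mulr1.
  move=> i ij; under eq_bigr do rewrite mulrCA.
  by rewrite -mulr_sumr bbeta eq_sym (negbTE ij) mulr0.
rewrite (bigID (mem F))/= [X in X + _]big1 ?add0r.
  apply: eq_big => [e|e /andP[eG eF]]; first by rewrite inS andbC.
  have eS : e \in S by rewrite inS eF.
  by rewrite dot_a// /beta'; field; rewrite gt_eqF// cS.
move=> e /andP[_ eF]; rewrite big1 ?mulr0// => i _.
by rewrite (bV i).2// mulr0.
Qed.

Let dot_mu p kap : dot (mu p) kap = \sum_(e in S) psi p e * dot (a e) kap.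
Proof.
rewrite /dot /mu; under eq_bigr do rewrite mulr_suml.
rewrite exchange_big /=; apply: eq_bigr => e _; rewrite mulr_sumr.
by apply: eq_bigr => j _; rewrite mulrA.
Qed.

Let dot_mu_gam p : dot (mu p) gam = Sm p.
Proof. by rewrite dot_mu; apply: eq_bigr => e eS; rewrite agam// mulr1. Qed.

Let dotZ s (x y : 'I_k -> R) : dot (fun j => s * x j) y = s * dot x y.
Proof. by rewrite /dot mulr_sumr; apply: eq_bigr => j _; rewrite mulrA. Qed.

Let tau_Sm p : [/\ 0 <= tau p, tau p <= Sm p & tau p = 0 -> Sm p = 0].
Proof.
have [h1 [e eS h2]] := (tauP p _).1 erefl; split.
- by rewrite h2.
- by rewrite h2 /Sm (bigD1 e)//= lerDl sumr_ge0.
- move=> t0; rewrite /Sm big1// => i iS; apply/eqP.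
  by rewrite eq_le psi_ge0 andbT -t0 h1.
Qed.

Let Psi_gam p : dot (Psi p) gam = tau p.
Proof.
rewrite /Psi dotZ dot_mu_gam; have [t0 tS ht] := tau_Sm p.
have [S0|S0] := eqVneq (Sm p) 0; last by rewrite divfK.
by rewrite S0 mulr0; apply/eqP; rewrite eq_le t0 -S0 tS.
Qed.

Let psi_continuous e : e \in S -> continuous (fun p : PE R E => psi p e).
Proof.
move=> eS p; apply: (@continuous_comp (PE R E) (P1 R) R (fun p : PE R E => p e)).
  exact: continuous_coord.
exact: P1_exp_continuous (cS eS) _.
Qed.

Let tau_continuous : continuous tau.
Proof.
apply: (@continuousNr R (PE R E)).
(* [psi] is known to be continuous only where [c e > 0], so the entries off [S], which the minimum
   never reads, are replaced by 0. *)
pose f (p : PE R E) e := if e \in S then - psi p e else 0.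
have -> : (fun p => fmin S e0 (fun e => - psi p e)) = fun p => fmin S e0 (f p).
  apply/funext => p; rewrite /fmin /f; rewrite [e0 \in S]e0S.
  by apply: eq_bigr => e ->.
apply: (@fmin_continuous R E (PE R E)) => e; rewrite /f.
have [eS|eS] := boolP (e \in S); last exact: continuous_cstr.
by apply: (@continuousNr R (PE R E)); exact: psi_continuous.
Qed.

(* Where all the weights vanish the quotient is bounded by a multiple of tau. *)
Let Psi_continuous : continuous Psi.
Proof.
apply: continuous_ptws => j p.
have ct : tau q @[q --> p] --> tau p := @tau_continuous p.
have cSm : Sm q @[q --> p] --> Sm p.
  apply: (@continuous_sumr R (PE R E) _ _ (mem S) (fun e p => psi p e)) => e eS.
  exact: psi_continuous.
have cmu : mu q j @[q --> p] --> mu p j.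
  apply: (@continuous_sumr R (PE R E) _ _ (mem S) (fun e p => psi p e * a e j)) => e eS.
  by apply: (@continuousMr R (PE R E)); [exact: psi_continuous|exact: continuous_cstr].
have [S0|S0] := eqVneq (Sm p) 0; last exact: (cvgM (cvgM ct (cvgV S0 cSm)) cmu).
have [t0 tS _] := tau_Sm p.
have tp : tau p = 0 by apply/eqP; rewrite eq_le t0 -S0 tS.
have Pp : Psi p j = 0 by rewrite /Psi tp !mul0r.
suff : (fun q : PE R E => Psi q j) @ p --> (0 : R) by rewrite -Pp.
pose B := 1 + \sum_(e in S) `|a e j|.
have B0 : 0 < B by rewrite ltr_pwDl// sumr_ge0.
have PB q : `|Psi q j| <= tau q * B.
  have [tq0 _ _] := tau_Sm q.
  have Sq0 : 0 <= Sm q by apply: sumr_ge0 => e _; exact: psi_ge0.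
  rewrite /Psi normrM normrM (ger0_norm tq0) normfV (ger0_norm Sq0) -mulrA ler_wpM2l//.
  have [->|Sq] := eqVneq (Sm q) 0; first by rewrite invr0 mul0r ltW.
  have Sq1 : 0 < Sm q by rewrite lt_neqAle eq_sym Sq.
  rewrite mulrC ler_pdivrMr//; apply: le_trans (ler_norm_sum _ _ _) _.
  rewrite /Sm mulr_sumr; apply: ler_sum => e eS.
  rewrite normrM (ger0_norm (psi_ge0 _ _)) mulrC ler_wpM2r//.
  by rewrite /B (bigD1 e)//= addrCA lerDl addr_ge0// sumr_ge0.
apply/(@cvgrPdist_lt _ R^o _ _ (nbhs_filter p)) => eps eps0.
have eB : 0 < eps / B by rewrite divr_gt0.
have := (@cvgrPdist_lt _ R^o _ _ (nbhs_filter p) _ _).1 ct _ eB.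
apply: (@filterS _ _ (nbhs_filter p)) => q hq.
have {}hq : `|tau p - tau q| < eps / B := hq.
suff : `|0 - Psi q j| < eps by [].
have [tq0 _ _] := tau_Sm q.
rewrite sub0r (normrN (Psi q j)); apply: le_lt_trans (PB q) _.
move: hq; rewrite tp sub0r (normrN (tau q)) (ger0_norm tq0).
by rewrite ltr_pdivlMr.
Qed.

(** Pairing mu q - mu p = 0 with the difference of two lifts gives a vanishing sum of non-negative
    terms, so each term vanishes. The thresholds are crossed: each lift exceeds the finite
    coordinates of the other point. *)
Let lift_inj p q : nonneg_pt p -> nonneg_pt q -> lifts V p -> lifts V q ->
  (forall e, e \in F -> p e = Some 0) -> (forall e, e \in F -> q e = Some 0) ->
  mu p = mu q -> forall e, e \in S -> p e = q e.
Proof.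
move=> p0 q0 pl ql pF qF pq.
have [Mp _ hMp] := fin_bound (fun e => odflt 0 (p e : option R)).
have [Mq _ hMq] := fin_bound (fun e => odflt 0 (q e : option R)).
have [v [Vv va vN]] := pl Mq; have [w [Vw wa wN]] := ql Mp.
pose u e := v e - w e.
have uW : vanish_on V F u.
  split; first exact: subspaceB.
  by move=> e eF; rewrite /u (va _ _ (pF _ eF)) (wa _ _ (qF _ eF)) subrr.
pose kap j := \sum_(i in G) beta j i * u i.
have ukap e : e \in S -> dot (a e) kap = u e / c e.
  by move=> eS; rewrite dot_a// -(bspan uW (SG eS)).
have sum0 : \sum_(e in S) (psi q e - psi p e) * (u e / c e) = 0.
  have := congr1 (fun x => dot x kap) pq; rewrite !dot_mu => h.
  rewrite (eq_bigr (fun e => psi q e * dot (a e) kap - psi p e * dot (a e) kap)).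
    by rewrite sumrB -h subrr.
  by move=> e eS; rewrite ukap// mulrBl.
have mono e : e \in S -> 0 <= (psi q e - psi p e) * (u e / c e) /\
    ((psi q e - psi p e) * (u e / c e) = 0 -> p e = q e).
  move=> eS; apply: P1_exp_mono => //; first exact: cS.
  - by move=> x; exact: p0.
  - by move=> x; exact: q0.
  - by move=> x y px qy; rewrite /u (va _ _ px) (wa _ _ qy).
  - move=> x px qN; rewrite /u (va _ _ px) subr_lt0; apply: le_lt_trans (wN _ qN).
    by have := hMp e; rewrite px.
  - move=> y pN qy; rewrite /u (wa _ _ qy) subr_gt0; apply: le_lt_trans (vN _ pN).
    by have := hMq e; rewrite qy.
move=> e eS; apply: (mono e eS).2.
by apply: (psumr_eq0P _ sum0) => // i iS; exact: (mono i iS).1.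
Qed.

Let Y := Y_tnn_closed_cell V F G.

Let YP p : Y p <-> [/\ tnn_schubert V p,
    forall e, e \in F -> p e = Some 0 & forall e, e \notin G -> p e = None].
Proof.
have aF : is_acyclic_flat V F by apply: acyclic_flatI; exists c.
by rewrite /Y closed_cellP.
Qed.

(* Adding t c to q multiplies all the weights by e^-t, so proportional weights can be made
   equal by a translation inside the cell. *)
Let Psi_inj_le p q : Y p -> Y q -> Psi p = Psi q -> 0 < Sm p -> Sm p <= Sm q -> p = q.
Proof.
move=> /YP[/(tnn_schubertP _ hV)[p0 pl] pF pG] /YP[/(tnn_schubertP _ hV)[q0 ql] qF qG].
move=> pq Sp Spq; have Sq : 0 < Sm q by exact: lt_le_trans Spq.
have tpq : tau p = tau q by rewrite -!Psi_gam pq.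
have tp : 0 < tau p.
  have [t0 _ ht] := tau_Sm p; rewrite lt_neqAle t0 andbT eq_sym; apply/eqP => /ht S0.
  by rewrite S0 ltxx in Sp.
pose s := Sm p / Sm q; have s0 : 0 < s by rewrite divr_gt0.
have s1 : s <= 1 by rewrite ler_pdivrMr// mul1r.
(* The ordering of [Sm p] and [Sm q] makes t >= 0, so the translate [q'] stays non-negative. *)
pose t := - ln s; have t0 : 0 <= t by rewrite oppr_ge0 ln_le0.
pose q' : PE R E := fun e => if q e is Some x then Some (x + t * c e) else None.
have psiq' e : e \in S -> psi q' e = s * psi q e.
  move=> eS; rewrite /psi /q'; case qe : (q e) => [x|] /=; last by rewrite mulr0.
  have x0 := q0 _ _ qe; have ce := cS eS.
  have tc : 0 <= t * c e by rewrite mulr_ge0// ltW.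
  rewrite !ger0_norm ?addr_ge0// mulrDl mulfK ?gt_eqF// opprD expRD mulrC.
  by rewrite /t opprK lnK// posrE.
have c0 e : 0 <= c e.
  by have [/cF ->//|/cpos/ltW] := boolP (e \in F).
have q'0 : nonneg_pt q'.
  move=> e x; rewrite /q'; case qe : (q e) => [y|] // [<-].
  by rewrite addr_ge0 ?mulr_ge0//; exact: q0 qe.
have q'l : lifts V q'.
  move=> M; have [v [Vv va vN]] := ql M.
  exists (fun e => t * c e + v e); split; first exact: hV.2.
    by move=> e x; rewrite /q'; case qe : (q e) => [y|] // [<-]; rewrite (va _ _ qe) addrC.
  move=> e; rewrite /q'; case qe : (q e) => [y|] // _.
  by apply: lt_le_trans (vN _ qe) _; rewrite lerDr mulr_ge0.
have q'F e : e \in F -> q' e = Some 0.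
  by move=> eF; rewrite /q' qF// cF// mulr0 addr0.
have mupq' : mu p = mu q'.
  apply/funext => j; have h := congr1 (fun f => f j) pq.
  have -> : mu p j = Psi p j * (Sm p / tau p) by rewrite /Psi; field; rewrite !gt_eqF.
  rewrite h /Psi tpq; have tq : 0 < tau q by rewrite -tpq.
  transitivity (s * mu q j); first by rewrite /s; field; rewrite !gt_eqF.
  by rewrite /mu mulr_sumr; apply: eq_bigr => e eS; rewrite psiq'// mulrA.
have pq' := lift_inj p0 q'0 pl q'l pF q'F mupq'.
(* The translate has largest weight [s * tau q], yet it agrees with [p] on [S], and [tau p = tau q]
   is positive. *)
have s1' : s = 1.
  have tq' : tau q' = s * tau q.
    have [h1 [e eS h2]] := (tauP q _).1 erefl.
    apply/tauP; split=> [i iS|]; first by rewrite psiq'// ler_pM2l// h1.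
    by exists e => //; rewrite psiq'// h2.
  have tp' : tau q' = tau p.
    have [h1 [e eS h2]] := (tauP p _).1 erefl.
    apply/tauP; split=> [i iS|]; first by rewrite /psi -pq'// h1.
    by exists e => //; rewrite h2 /psi pq'.
  by apply: (mulIf (lt0r_neq0 tp)); rewrite mul1r {1}tpq -tq'.
apply/funext => e; have [eF|eF] := boolP (e \in F); first by rewrite pF// qF.
have [eG|eG] := boolP (e \in G); last by rewrite pG// qG.
rewrite pq' ?inS ?eF// /q' /t s1' ln1 oppr0.
by case: (q e) => // x; rewrite mul0r addr0.
Qed.

Let Psi_inj p q : Y p -> Y q -> Psi p = Psi q -> p = q.
Proof.
move=> Yp Yq pq.
have tpq : tau p = tau q by rewrite -!Psi_gam pq.
have S_ge0 r : 0 <= Sm r by apply: sumr_ge0 => e _; exact: psi_ge0.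
have S0E r : tau r = 0 -> forall e, e \in S -> r e = None.
  move=> t0 e eS; have [h1 _] := (tauP r _).1 erefl; have := h1 e eS.
  rewrite t0 /psi; case: (r e) => //= x; rewrite leNgt expR_gt0.
  by [].
(* All weights vanish: both points are the one whose coordinates in [S] are all infinite. *)
have [tp|tp] := eqVneq (tau p) 0.
  have tq : tau q = 0 by rewrite -tpq.
  have /YP[_ pF pG] := Yp; have /YP[_ qF qG] := Yq.
  apply/funext => e; have [eF|eF] := boolP (e \in F); first by rewrite pF// qF.
  have [eG|eG] := boolP (e \in G); last by rewrite pG// qG.
  by rewrite !S0E// inS eF.
have Spos r : tau r != 0 -> 0 < Sm r.
  move=> tr; have [t0 tS _] := tau_Sm r; apply: lt_le_trans tS.
  by rewrite lt_neqAle eq_sym tr.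
have [h|/ltW h] := leP (Sm p) (Sm q); first by apply: Psi_inj_le => //; exact: Spos.
by apply/esym; apply: Psi_inj_le => //; apply: Spos; rewrite -tpq.
Qed.

(* The interior of the dual cone, truncated by [xi(c) < 1]; the uniform [delta] makes openness
   and coercivity immediate. *)
Definition open_body : set ('I_k -> R) := [set xi |
  (exists2 delta : R, 0 < delta & forall kap, (forall e, e \in S -> 0 <= dot (a e) kap) ->
     delta * \sum_(e in S) dot (a e) kap <= dot xi kap) /\ dot xi gam < 1].

Let Psi_cell p : Y_tnn_cell V F G p -> open_body (Psi p).
Proof.
move=> cp; have [v [Vv pv v0 v1 _]] := cell_lift hV FG cp 0.
have pe e : e \in S -> psi p e = expR (- (v e / c e)).
  move=> eS; rewrite /psi pv /chart SG//= gtr0_norm// v1//.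
  by move: eS; rewrite inS => /andP[].
have [t0 tS ht] := tau_Sm p.
have [h1 [e1 e1S h2]] := (tauP p _).1 erefl.
have tp : 0 < tau p by rewrite h2 pe// expR_gt0.
have Sp : 0 < Sm p by apply: lt_le_trans tS.
split; last first.
  rewrite Psi_gam h2 pe// expR_lt1 oppr_lt0 divr_gt0 ?cS// v1//.
  by move: e1S; rewrite inS => /andP[].
pose m := fmin S e0 (psi p).
have [m1 [e2 e2S m2]] := (fmin_eqP (psi p) m e0S).1 erefl.
have m0 : 0 < m by rewrite m2 pe// expR_gt0.
exists (tau p / Sm p * m); first by rewrite mulr_gt0// divr_gt0.
move=> kap kap0; rewrite /Psi dotZ dot_mu -[leLHS]mulrA ler_pM2l ?divr_gt0//.
by rewrite mulr_sumr; apply: ler_sum => e eS; rewrite ler_wpM2r ?kap0// m1.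
Qed.

(** The exponential family realises [xi] at some vector of W without regard to signs. A translation
    along [c] then keeps the ray and makes the largest weight equal to xi(c) < 1, which forces
    positive coordinates. *)
Let Psi_cell_surj xi : open_body xi -> exists2 p, Y_tnn_cell V F G p & Psi p = xi.
Proof.
move=> [[delta delta0 hxi] xig].
have [lam hlam] := exponential_family_surj e0S agam abeta delta0 hxi.
pose Z := \sum_(e in S) expR (- dot (a e) lam).
have xigZ : dot xi gam = Z.
  transitivity (dot (fun j => \sum_(e in S) expR (- dot (a e) lam) * a e j) gam).
    by congr dot; apply/funext => j; rewrite hlam.
  rewrite /dot; under eq_bigr do rewrite mulr_suml.
  rewrite exchange_big /=; apply: eq_bigr => e eS.
  rewrite -[RHS]mulr1 -(agam eS) /dot mulr_sumr; apply: eq_bigr => j _; by rewrite mulrA.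
have Z0 : 0 < Z.
  rewrite /Z (bigD1 e0)//= ltr_pwDl ?expR_gt0// sumr_ge0// => e _; exact: expR_ge0.
rewrite xigZ in xig.
pose n := fmin S e0 (fun e => dot (a e) lam).
have [nle [e1 e1S ne1]] := (fmin_eqP (fun e => dot (a e) lam) n e0S).1 erefl.
(* The least ratio v_e / c_e becomes t + n = - ln Z > 0, hence the largest weight is Z. *)
pose t := - ln Z - n.
pose v e := t * c e + \sum_j lam j * b j e.
have vW : vanish_on V F v.
  have hW := vanish_on_subspace F hV.
  by apply: hW.2; [split|exact: subspace_sum].
have vc e : e \in S -> v e / c e = t + dot (a e) lam.
  by move=> eS; rewrite /v mulrDl mulfK ?gt_eqF ?cS// dot_a.
have lnZ : 0 < - ln Z by rewrite oppr_gt0 ln_lt0// Z0.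
have v0 e : e \in S -> 0 < v e.
  move=> eS; rewrite -[v e](divfK (lt0r_neq0 (cS eS))) mulr_gt0 ?cS// vc//.
  by have := nle e eS; rewrite /t; lra.
exists (chart G v).
  by case: vW => Vv vF; apply: chart_cell.
have psiE e : e \in S -> psi (chart G v) e = expR (- t) * expR (- dot (a e) lam).
  by move=> eS; rewrite /psi /chart SG//= gtr0_norm ?v0// vc// opprD expRD.
have muE j : mu (chart G v) j = expR (- t) * xi j.
  by rewrite /mu -hlam mulr_sumr; apply: eq_bigr => e eS; rewrite psiE// mulrA.
have SmE : Sm (chart G v) = expR (- t) * Z.
  by rewrite /Sm /Z mulr_sumr; apply: eq_bigr => e eS; rewrite psiE.
have tauE : tau (chart G v) = Z.
  have ZE : Z = expR (- t) * expR (- n) by rewrite -expRD /t opprB opprK addrAC subrr add0r lnK.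
  apply/tauP; split=> [e eS|].
    by rewrite psiE// ZE ler_pM2l ?expR_gt0// ler_expR lerN2 nle.
  by exists e1 => //; rewrite psiE// ZE ne1.
apply/funext => j; rewrite /Psi muE SmE tauE.
by field; rewrite !gt_eqF// expR_gt0.
Qed.

(** * The body is open, bounded and convex *)

Let B := 1 + \sum_i \sum_(e in S) `|beta' i e|.

Let B0 : 0 < B.
Proof. by rewrite ltr_pwDl//; do 2 (apply: sumr_ge0 => ? _). Qed.

Let dot_bound (y kap : 'I_k -> R) r : (forall i, `|y i| <= r) -> 0 <= r ->
  (forall e, e \in S -> 0 <= dot (a e) kap) ->
  `|dot y kap| <= r * (k%:R * B * \sum_(e in S) dot (a e) kap).
Proof.
move=> yr r0 kap0; apply: le_trans (ler_norm_sum _ _ _) _.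
have sg0 : 0 <= \sum_(e in S) dot (a e) kap by apply: sumr_ge0.
apply: (@le_trans _ _ (\sum_(i < k) r * (B * \sum_(e in S) dot (a e) kap))).
  apply: ler_sum => i _; rewrite normrM; apply: ler_pM => //.
  apply: le_trans (coord_bound abeta i kap0) _.
  by rewrite ler_wpM2r// /B lerDr.
by rewrite sumr_const card_ord -mulr_natl le_eqVlt; apply/orP; left; apply/eqP; ring.
Qed.

Let open_body_open xi : open_body xi -> exists2 r : R, 0 < r &
  forall y : 'I_k -> R, (forall i, `|y i| <= r) -> open_body (fun i => xi i + y i).
Proof.
move=> [[delta delta0 hxi] xig].
have dotD (x y z : 'I_k -> R) : dot (fun i => x i + y i) z = dot x z + dot y z.
  by rewrite /dot -big_split; apply: eq_bigr => i _ /=; rewrite mulrDl.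
pose Gm := \sum_(e in S) dot (a e) gam.
have gam0 e : e \in S -> 0 <= dot (a e) gam by move=> eS; rewrite agam.
have Gm0 : 0 <= Gm by apply: sumr_ge0.
pose C := 1 + k%:R * B.
have C0 : 0 < C by rewrite ltr_pwDl// mulr_ge0// ltW.
(* A perturbation below [r1] costs at most half of delta, and one below [r2] at most half of the
   slack 1 - xi(c). *)
pose r1 := delta / (2 * C); pose r2 := (1 - dot xi gam) / (2 * (1 + C * Gm)).
have CG : 0 <= C * Gm by rewrite mulr_ge0// ltW.
have r10 : 0 < r1 by rewrite divr_gt0// mulr_gt0.
have r20 : 0 < r2 by rewrite divr_gt0 ?subr_gt0// mulr_gt0// ltr_pwDl.
exists (Num.min r1 r2); first by rewrite lt_min r10.
move=> y hy; split.
  exists (delta / 2); first by rewrite divr_gt0.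
  move=> kap kap0; rewrite dotD; have h := hxi _ kap0.
  have yr i : `|y i| <= r1 by apply: le_trans (hy i) _; rewrite ge_min lexx.
  have := dot_bound yr (ltW r10) kap0; set sg := \sum_(e in S) _ in h *.
  have sg0 : 0 <= sg by apply: sumr_ge0.
  have : r1 * (k%:R * B * sg) <= delta / 2 * sg.
    rewrite !mulrA; apply: ler_wpM2r => //.
    rewrite -mulrA /r1 invfM !mulrA -[leRHS]mulr1 -[leLHS]mulrA -[leLHS]mulrA.
    rewrite ler_pM2l ?divr_gt0// mulrC ler_pdivrMr// mul1r /C; lra.
  by rewrite ler_norml; lra.
rewrite dotD.
have yr i : `|y i| <= r2 by apply: le_trans (hy i) _; rewrite ge_min lexx orbT.
have := dot_bound yr (ltW r20) gam0; rewrite -/Gm.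
have h2 : r2 * (k%:R * B * Gm) <= r2 * (1 + C * Gm).
  by rewrite ler_pM2l// /C mulrDl mul1r; lra.
have h3 : r2 * (1 + C * Gm) = (1 - dot xi gam) / 2.
  by rewrite /r2; field; rewrite gt_eqF// ltr_pwDl.
by rewrite ler_norml; lra.
Qed.

(** Every functional is 1 on [gam] and has coordinates at most [M], so moving [gam] by 1 / M either
    way along a basis vector stays in the cone. Positivity of [xi] there gives |xi_i| / M <= xi(c) <
    1. *)
Let open_body_bounded : exists2 M : R, 0 < M &
  forall xi, open_body xi -> forall i, `|xi i| <= M.
Proof.
pose M := 1 + \sum_(e in S) \sum_j `|a e j|.
have M0 : 0 < M by rewrite ltr_pwDl//; do 2 (apply: sumr_ge0 => ? _).
exists M => // xi [[delta delta0 hxi] xig] i.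
have aM e : e \in S -> `|a e i| <= M.
  move=> eS; apply: (@le_trans _ _ (\sum_j `|a e j|)).
    by rewrite (bigD1 i)//= lerDl sumr_ge0.
  rewrite /M (bigD1 e)//= addrCA lerDl addr_ge0//.
  by do 2 (apply: sumr_ge0 => ? _).
have key s : `|s| <= M^-1 -> 0 <= dot xi gam + s * xi i.
  move=> sM; pose kap j := gam j + s * (j == i)%:R.
  have kapE (x : 'I_k -> R) : dot x kap = dot x gam + s * x i.
    by rewrite /kap dotDr dot_unit.
  have kap0 e : e \in S -> 0 <= dot (a e) kap.
    move=> eS; rewrite kapE agam//.
    have : `|s * a e i| <= M^-1 * M by rewrite normrM ler_pM// aM.
    by rewrite mulVf ?gt_eqF// ler_norml; lra.
  rewrite -kapE; apply: le_trans (hxi _ kap0).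
  by apply: mulr_ge0; [exact: ltW|apply: sumr_ge0 => e; exact: kap0].
have Mi : 0 < M^-1 by rewrite invr_gt0.
have h1 : 0 <= dot xi gam + M^-1 * xi i by apply: key; rewrite gtr0_norm.
have h2 : 0 <= dot xi gam + (- M^-1) * xi i by apply: key; rewrite normrN gtr0_norm.
rewrite mulNr in h2.
have : `|M^-1 * xi i| <= 1 by rewrite ler_norml; lra.
by rewrite normrM (gtr0_norm Mi) mulrC ler_pdivrMr// mul1r.
Qed.

Let open_body_convex x y (t : R) : open_body x -> open_body y -> 0 <= t -> t <= 1 ->
  open_body (fun i => (1 - t) * x i + t * y i).
Proof.
have dotC (z : 'I_k -> R) :
    dot (fun i => (1 - t) * x i + t * y i) z = (1 - t) * dot x z + t * dot y z.
  by rewrite /dot !mulr_sumr -big_split; apply: eq_bigr => i _ /=; ring.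
move=> [[dx dx0 hx] xg] [[dy dy0 hy] yg] t0 t1; split.
  exists (Num.min dx dy); first by rewrite lt_min dx0.
  move=> kap kap0; rewrite dotC; have := hx _ kap0; have := hy _ kap0.
  set sg := \sum_(e in S) _; have sg0 : 0 <= sg by apply: sumr_ge0.
  set d := Num.min dx dy => hyk hxk.
  have dxs : d * sg <= dot x kap by apply: le_trans hxk; rewrite ler_wpM2r// ge_min lexx.
  have dys : d * sg <= dot y kap by apply: le_trans hyk; rewrite ler_wpM2r// ge_min lexx orbT.
  have -> : d * sg = (1 - t) * (d * sg) + t * (d * sg) by ring.
  by apply: lerD; rewrite ler_wpM2l// subr_ge0.
rewrite dotC; have [t00|t00] := eqVneq t 0.
  by rewrite t00 subr0 mul1r mul0r addr0.
have tp : 0 < t by rewrite lt_neqAle eq_sym t00.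
rewrite [ltRHS](_ : 1 = (1 - t) * 1 + t * 1); last by ring.
apply: ler_ltD; first by rewrite ler_wpM2l ?subr_ge0// ltW.
by rewrite ltr_pM2l.
Qed.

Lemma closed_cell_ball_coords : exists phi : {ptws 'I_k -> R} -> PE R E,
  homeo_on (euclid_closed_ball R k) Y phi /\
  phi @` euclid_open_ball R k = Y_tnn_cell V F G.
Proof.
have [p0 cp0] : Y_tnn_cell V F G !=set0.
  apply/(cell_nonempty hV FG); split=> //.
  by apply: acyclic_flatI; exists c.
(* The gauge needs the origin inside the body, so the body is recentred at the image of a point of
   the cell. *)
pose xi0 := Psi p0.
pose O : set ('I_k -> R) := [set x | open_body (fun i => xi0 i + x i)].
have O0 : O (fun=> 0).
  by rewrite /O /=; under [X in open_body X]funext do rewrite addr0; exact: Psi_cell.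
have convO (x y : 'I_k -> R) (t : R) : O x -> O y -> 0 <= t -> t <= 1 ->
    O (fun i => (1 - t) * x i + t * y i).
  move=> Ox Oy t0 t1; have := open_body_convex Ox Oy t0 t1; rewrite /O /=.
  by congr open_body; apply/funext => i; ring.
have openO x : O x -> exists2 r : R, 0 < r &
    forall y : 'I_k -> R, (forall i, `|y i| <= r) -> O (fun i => x i + y i).
  move=> /open_body_open[r r0 hr]; exists r => // y /hr; rewrite /O /=.
  by congr open_body; apply/funext => i; rewrite addrA.
have bndO : exists2 M : R, 0 < M & forall x, O x -> forall i, `|x i| <= M.
  have [M M0 hM] := open_body_bounded; exists (M + M); first by rewrite addr_gt0.
  move=> x /hM h i; have h1 := h i; have h2 := hM _ (Psi_cell cp0) i.
  have -> : x i = (xi0 i + x i) - xi0 i by ring.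
  by apply: le_trans (ler_normB _ _) _; exact: lerD.
pose Xi (p : PE R E) : {ptws 'I_k -> R} := to_ball O (fun i => Psi p i - xi0 i).
have shiftE (z : 'I_k -> R) : (fun i => xi0 i + (z i - xi0 i)) = z.
  by apply/funext => i; ring.
have Xi_cont : continuous Xi.
  move=> p; apply: (@continuous_comp _ _ _
      (fun p => (fun i => Psi p i - xi0 i) : {ptws 'I_k -> R}) (to_ball O)).
    apply: continuous_ptws => i; apply: (@continuousBr R (PE R E)); last exact: continuous_cstr.
    move=> q; apply: (@continuous_comp (PE R E) {ptws 'I_k -> R} R Psi (fun z => z i)).
      exact: Psi_continuous.
    exact: continuous_coord.
  exact: (to_ball_continuous convO O0 openO).
have Xi_lt1 p : \sum_i Xi p i ^+ 2 < 1 <-> open_body (Psi p).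
  apply: iff_trans (to_ball_lt1 convO O0 openO _) _.
  by rewrite /O /= shiftE.
have Xi_inj p q : Y p -> Y q -> Xi p = Xi q -> p = q.
  move=> Yp Yq /(to_ball_inj convO O0 openO bndO) h; apply: Psi_inj => //.
  apply/funext => i; have := congr1 (fun f => f i) h => /= hi.
  by apply: (addIr (- xi0 i)).
have cellY p : Y_tnn_cell V F G p -> Y p by exact: subset_closure.
have Xi_open y : euclid_open_ball R k y -> exists2 p, Y_tnn_cell V F G p & Xi p = y.
  move=> y1; have [x hx] := to_ball_surj convO O0 openO bndO y.
  have Ox : O x by apply/(to_ball_lt1 convO O0 openO); rewrite hx.
  have [p cp pE] := Psi_cell_surj Ox; exists p => //.
  by rewrite -hx /Xi pE; congr to_ball; apply/funext => i; ring.
have cY : compact Y.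
  by apply: (subclosed_compact _ (@PE_compact R E)) => //; exact: closed_closure.
have hausX : hausdorff_space {ptws 'I_k -> R}.
  by apply: hausdorff_product => i; exact: Rhausdorff.
have cball : closed (euclid_closed_ball R k).
  apply: (@closed_comp _ _ (fun x : {ptws 'I_k -> R} => \sum_i x i ^+ 2) [set z | z <= 1]).
    move=> x _; apply: (@continuous_sumr R {ptws 'I_k -> R} _ _ xpredT (fun i y => y i ^+ 2)) => i _.
    by apply: (@continuousXr R {ptws 'I_k -> R} (fun y => y i)); exact: continuous_coord.
  exact: closed_le.
have XiY p : Y p -> euclid_closed_ball R k (Xi p).
  move=> Yp; have cl : closed (Xi @^-1` euclid_closed_ball R k).
    by apply: closed_comp => // x _; exact: Xi_cont.
  apply: (cl p); apply: (closureS _ Yp) => q cq /=.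
  by rewrite /euclid_closed_ball /=; apply: ltW; apply/Xi_lt1; exact: Psi_cell.
have Xi_surj y : euclid_closed_ball R k y -> exists2 p, Y p & Xi p = y.
  move=> y1; have clX : closed (Xi @` Y).
    apply: compact_closed => //; apply: continuous_compact => //.
    exact: continuous_subspaceT.
  suff : (Xi @` Y) y by case=> p Yp pE; exists p.
  (* The radial contractions (1 - 1 / (n + 1)) y lie in the open ball, starting from its centre at n
     = 0, and tend to y. *)
  apply: clX; apply: (@closure_seq _ _ (fun n => (fun i => y i + (- y i) / n.+1%:R) : {ptws 'I_k -> R})).
    move=> n; have [p cp pE] : exists2 p, Y_tnn_cell V F G p &
        Xi p = (fun i => y i + (- y i) / n.+1%:R).
      apply: Xi_open; rewrite /euclid_open_ball /=.
      pose s : R := 1 - n.+1%:R^-1.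
      have n0 : 0 < n.+1%:R^-1 :> R by rewrite invr_gt0 ltr0n.
      have n1 : n.+1%:R^-1 <= 1 :> R by rewrite invf_le1 ?ltr0n// ler1n.
      rewrite (eq_bigr (fun i => s ^+ 2 * y i ^+ 2)); last by move=> i _; rewrite /s; ring.
      rewrite -mulr_sumr; apply: (@le_lt_trans _ _ (s ^+ 2)).
        by rewrite ler_piMr// sqr_ge0.
      by rewrite expr_lt1// ?subr_ge0// ltrBlDr ltrDl.
    by exists p => //; exact: cellY.
  by apply: cvg_ptws => i; exact: cvg_shrink.
pose phi (y : {ptws 'I_k -> R}) : PE R E :=
  if pselect (exists2 p, Y p & Xi p = y) is left h then proj1_sig (cid2 h) else p0.
have phiP y : euclid_closed_ball R k y -> Y (phi y) /\ Xi (phi y) = y.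
  move=> /Xi_surj h; rewrite /phi; case: pselect => // h'.
  by case: (cid2 h') => p Yp pE.
have phiK p : Y p -> phi (Xi p) = p.
  by move=> Yp; have [Yq qE] := phiP _ (XiY _ Yp); exact: Xi_inj.
exists phi; split.
  apply: (@compact_homeo_on _ _ Y (euclid_closed_ball R k) Xi phi) => //.
  - exact: continuous_subspaceT.
  - by move=> y /phiP[].
  - by move=> y /phiP[].
apply/seteqP; split=> [_ [y /Xi_open[p cp <-] <-]|p cp].
  by rewrite phiK//; exact: cellY.
exists (Xi p); last by rewrite phiK//; exact: cellY.
by rewrite /euclid_open_ball /=; apply/Xi_lt1; exact: Psi_cell.
Qed.

End ClosedCellBall.

Lemma closed_cell_ball (R : realType) (E : finType) (V : set (E -> R)) (F G : {set E}) :
  is_subspace V -> F \subset G -> Y_tnn_cell V F G !=set0 ->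
  exists d (phi : {ptws 'I_d -> R} -> PE R E),
    homeo_on (euclid_closed_ball R d) (Y_tnn_closed_cell V F G) phi /\
    phi @` euclid_open_ball R d = Y_tnn_cell V F G.
Proof.
move=> hV FG ne; have [aF aG] := (cell_nonempty hV FG).1 ne.
have [_ [c [Vc cF cpos]]] := aF.
(* If F = G there is no weight to maximise over; the closed cell is a point, matched with the ball
   of dimension 0. *)
have [GF0|/set0Pn[e0 e0S]] := eqVneq (G :\: F) finset.set0; last first.
  have [k [b [beta [bV bbeta bspan _]]]] :=
    relative_basis G (vanish_on_subspace F hV).
  have [phi hphi] := closed_cell_ball_coords hV FG aG bV bbeta bspan Vc cF cpos e0S.
  by exists k, phi.
have [p cp] := ne; have Yp : Y_tnn_closed_cell V F G p by exact: subset_closure.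
have GF e : e \in G -> e \in F.
  move=> eG; apply: contraT => eF.
  by have := finset.in_set0 e; rewrite -GF0 inE eF eG.
have Y1 q : Y_tnn_closed_cell V F G q -> q = p.
  move: Yp; rewrite closed_cellP// => -[_ pF pG] [_ qF qG].
  apply/funext => e; have [/GF eF|eG] := boolP (e \in G); first by rewrite pF// qF.
  by rewrite pG// qG.
have ball0 x : euclid_open_ball R 0 x by rewrite /euclid_open_ball /= big_ord0.
exists 0%N, (fun=> p); split.
  exists (fun _ _ => 0); split=> //.
  - by move=> y _; rewrite /euclid_closed_ball /= big_ord0.
  - by move=> x _; apply/funext => -[].
  - by move=> y /Y1.
  - by split; apply: continuous_subspaceT => x; exact: cst_continuous.
apply/seteqP; split=> [_ [x _ <-]//|q cq].
by exists (fun=> 0) => //; apply/esym/Y1; exact: subset_closure.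
Qed.

Theorem theorem1p1 (R : realType) (E : finType) (V : set (E -> R))
    (hV : is_subspace V) :
  (* (1) *)
  (forall F G : {set E}, F \subset G ->
     (Y_tnn_cell V F G !=set0 <-> is_acyclic_flat V F /\ is_acyclic_flat V G) /\
     (Y_tnn_cell V F G !=set0 ->
        (forall p, Y_tnn_cell V F G p ->
           connected_component (Y_alg_cell V F G) p = Y_tnn_cell V F G) /\
        (forall rF rG, is_rank V F rF -> is_rank V G rG ->
           let A := [set x : {ptws E -> R} |
                      (forall e, e \notin G -> x e = 0) /\
                      Y_tnn_cell V F G (chart G x)] in
           semialg A /\
           exists h : {ptws E -> R} -> {ptws 'I_(rG - rF) -> R},
             homeo_on A (pos_orthant R (rG - rF)) h /\
             semialg (graph_on A h)))) /\
  (* (2) *)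
  (forall F G : {set E}, F \subset G -> Y_tnn_cell V F G !=set0 ->
     Y_tnn_closed_cell V F G =
       [set p | exists F' G' : {set E},
          sub_pair V F G F' G' /\ Y_tnn_cell V F' G' p] /\
     (forall F1 G1 F2 G2 : {set E}, (F1, G1) <> (F2, G2) ->
        Y_tnn_cell V F1 G1 `&` Y_tnn_cell V F2 G2 = set0)) /\
  (* (3) *)
  (forall F G : {set E}, F \subset G -> Y_tnn_cell V F G !=set0 ->
     regular_cw (Y_tnn_closed_cell V F G)
       [set c | exists F' G' : {set E},
          sub_pair V F G F' G' /\ c = Y_tnn_cell V F' G'] /\
     exists (d : nat) (phi : {ptws 'I_d -> R} -> PE R E),
       homeo_on (euclid_closed_ball R d) (Y_tnn_closed_cell V F G) phi).
Proof.
split; [|split] => F G FG.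
- split; first exact: cell_nonempty.
  move=> ne; have [aF aG] := (cell_nonempty hV FG).1 ne; split.
    by move=> p; exact: cell_component.
  move=> rF rG hF hG A.
  have [k [b [beta [bV bbeta bspan dimk]]]] :=
    relative_basis G (vanish_on_subspace F hV).
  rewrite vanish_on_vanish_on// in dimk.
  (* The number of chart coordinates is dim V_F - dim V_G, which is the difference of ranks. *)
  rewrite (rank_diff hV FG hF hG dimk); split.
    exact: (open_cell_semialg hV FG aG bV bspan).
  exact: (open_cell_homeo hV FG aF aG bV bbeta bspan).
- by move=> ne; split; [exact: closed_cell_decomp|exact: cells_disjoint].
- move=> ne; split; last first.
    by have [d [phi [h _]]] := closed_cell_ball hV FG ne; exists d, phi.
  have sub_ne F' G' : sub_pair V F G F' G' -> Y_tnn_cell V F' G' !=set0.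
    by move=> [_ FG' _ aF' aG']; apply/(cell_nonempty hV FG').
  split.
  + apply: (@sub_finite_set _ _
      ((fun FG : {set E} * {set E} => Y_tnn_cell V FG.1 FG.2) @` setT)).
      by move=> _ [F' [G' [_ ->]]]; exists (F', G').
    by apply: finite_image; exact: finite_finset.
  + rewrite closed_cell_decomp//; apply/seteqP; split=> p.
      move=> [F' [G' [h cp]]]; exists (Y_tnn_cell V F' G') => //.
      by exists F', G'.
    by move=> [_ [F' [G' [h ->]]] cp]; exists F', G'.
  + by move=> _ [F' [G' [h ->]]]; exact: sub_ne.
  + move=> _ _ [F1 [G1 [h1 ->]]] [F2 [G2 [h2 ->]]] neq; apply: cells_disjoint.
    by move=> -[e1 e2]; apply: neq; rewrite e1 e2.
  + move=> _ [F' [G' [h ->]]]; have ne' := sub_ne _ _ h.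
    have [FF' FG' GG' aF' aG'] := h; split; first exact: closed_cell_ball.
    apply/seteqP; split=> p; last by move=> [c' [_ cc'] /cc'].
    (* The decomposition of the smaller closed cell uses pairs between [F'] and [G'], which are also
       pairs between [F] and [G]. *)
    move=> clp; have : Y_tnn_closed_cell V F' G' p by [].
    rewrite closed_cell_decomp// => -[F2 [G2 [h2 cp]]].
    have [FF2 FG2 GG2 aF2 aG2] := h2.
    exists (Y_tnn_cell V F2 G2) => //; split.
      exists F2, G2; split=> //; split=> //; first exact: fintype.subset_trans FF2.
      exact: fintype.subset_trans GG'.
    move=> q cq; suff : Y_tnn_closed_cell V F' G' q by [].
    by rewrite closed_cell_decomp//; exists F2, G2.
Qed.
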